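(* Let $\mathbf{W}$ be a Coxeter group with a fixed finite, totally ordered set $S$ of Coxeter generators. Then the Artin monoid $\mathbf{B}^+(\mathbf{W})$ admits as a coherent presentation the $(3,1)$-polygraph $\mathrm{Art}_3(\mathbf{W})$ made of Artin's presentation $\mathrm{Art}_2(\mathbf{W})$ together with exactly one $3$-cell $Z_{r,s,t}$ (with source and target as described in the context) for all elements $t>s>r$ of $S$ such that the subgroup $\mathbf{W}_{\{r,s,t\}}$ of $\mathbf{W}$ generated by $r,s,t$ is finite.
   Context: **Polygraphs and coherent presentations.** All $n$-categories are strict and globular; $f\star_i g$ is composition along $i$-cells in diagrammatic order, and $f\star_0 g$ is written $fg$. A $2$-polygraph consists of a set $\Sigma_0$ of $0$-cells, a set $\Sigma_1$ of generating $1$-cells with source and target in $\Sigma_0$ (generating the free category $\Sigma_1^*$), and a set $\Sigma_2$ of generating $2$-cells, each with source and target a pair of parallel $1$-cells of $\Sigma_1^*$. $\Sigma_2^\top$ denotes the free $(2,1)$-category it generates (all $2$-cells invertible for $\star_1$; inverse of $f$ written $f^-$). The category presented is the quotient of $\Sigma_1^*$ by the congruence generated by $\Sigma_2$. A $(3,1)$-polygraph $\Sigma$ is a $2$-polygraph together with a set $\Sigma_3$ of generating $3$-cells, each with source and target a pair of parallel $2$-cells of $\Sigma_2^\top$; the category it presents is the one presented by its underlying $2$-polygraph, and the $(2,1)$-category it presents is $\overline{\Sigma}=\Sigma_2^\top/\Sigma_3$ (identify $s(\gamma)$ and $t(\gamma)$ for all $\gamma\in\Sigma_3$). $\Sigma$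 is a coherent presentation of a category $\mathbf{C}$ if the category it presents is isomorphic to $\mathbf{C}$ and $\Sigma_3$ is a homotopy basis, i.e. any two parallel $2$-cells of $\Sigma_2^\top$ become equal in $\overline{\Sigma}$. A monoid is a category with one object. **Coxeter groups and Artin monoids.** $\mathbf{W}$ has presentation with generators $S$ and relations $(st)^{m_{st}}=1$, $m_{st}\in\mathbb{N}\cup\{\infty\}$ ($\infty$: no relation), $m_{st}=1$ iff $s=t$. Let $l$ be the length function. $\langle st\rangle^n$ is the word $sts\cdots$ of length $n$ in the free monoid $S^*$, alternating $s,t$ and starting with $s$. The Artin monoid $\mathbf{B}^+(\mathbf{W})$ is generated by $S$ subject to $\langle st\rangle^{m_{st}}=\langle ts\rangle^{m_{st}}$ for $s\ne t$ with $m_{st}<\infty$. $\mathrm{Art}_2(\mathbf{W})$ is the $2$-polygraph with one $0$-cell, the elements of $S$ as $1$-cells, and one $2$-cell $\gamma_{s,t}:\langle ts\rangle^{m_{st}}\Rightarrow\langle st\rangle^{m_{st}}$ for every $t>s$ in $S$ with $m_{st}$ finite. For $u,v\in\mathbf{W}$, $u$ is a divisor of $v$ if $v=uu'$ with $l(v)=l(u)+l(u')$; then $u'$ is the complement of $u$ in $v$. For $I\subseteq S$, $\mathbf{W}_I$ is the subgroup generated by $I$; if it is finite, $w_0(I)$ is its longest element. For $u\in\mathbf{W}\setminus\{1\}$, $d_u$ is the smallest element of $S$ dividing $u$. **The projection $\pi$.** For $u\in\mathbf{W}\setminus\{1\}$ define a word $\pi(u)\in S^*$ recursively: $\pi(s)=s$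 for $s\in S$, and $\pi(u)=s\,\pi(u')$ if $u\notin S$, where $s=d_u$ and $u'$ is the complement of $s$ in $u$. For $u,v\in\mathbf{W}\setminus\{1\}$ with $l(uv)=l(u)+l(v)$, define a $2$-cell $\pi(\alpha_{u,v}):\pi(u)\pi(v)\Rightarrow\pi(uv)$ of $\mathrm{Art}_2(\mathbf{W})^\top$ by the following (well-founded) recursion: - if $u\notin S$, write $u=su'$ with $s=d_u$ and $u'$ the complement of $s$ in $u$; then $\pi(\alpha_{u,v})=s\,\pi(\alpha_{u',v})\star_1\pi(\alpha_{s,u'v})$; - if $u=s\in S$ and $d_{sv}=s$, then $\pi(\alpha_{s,v})$ is the identity of $\pi(sv)$; - if $u=s\in S$, $r:=d_{sv}<s$ and $sv=w_0(\{r,s\})$, then $\pi(\alpha_{s,v})=\gamma_{r,s}$; - if $u=s\in S$, $r:=d_{sv}<s$ and $sv\neq w_0(\{r,s\})$, then $\mathbf{W}_{\{r,s\}}$ is finite and $v=xy$ with $l(v)=l(x)+l(y)$, $y\ne1$ and $sx=w_0(\{r,s\})$; then $\pi(\alpha_{s,v})=s\,\pi(\alpha_{x,y})^-\star_1\gamma_{r,s}\,\pi(y)\star_1\pi(\alpha_{sx,y})$. **The $3$-cells.** For $t>s>r$ in $S$ with $\mathbf{W}_{\{r,s,t\}}$ finite, let $u$ be the complement of $t$ in $w_0(\{s,t\})$ and $v$ the complement of $w_0(\{s,t\})$ in $w_0(\{r,s,t\})$. Then $Z_{r,s,t}$ is a $3$-cell with source $\gamma_{s,t}\,\pi(v)\star_1\pi(\alpha_{tu,v})$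 and target $t\,\pi(\alpha_{u,v})\star_1\pi(\alpha_{t,uv})$. *)

(* Defs.v *)
From HB Require Import structures.
From mathcomp Require Import all_boot all_order generic_quotient.
From mathcomp Require Import boolp classical_sets cardinality.

Set Implicit Arguments.
Unset Strict Implicit.
Unset Printing Implicit Defensive.

Local Open Scope classical_set_scope.
Local Open Scope group_scope.
Local Open Scope quotient_scope.

(* Composition is in diagrammatic order. *)
Record category := Category {
  ob : Type;
  hom : ob -> ob -> Type;
  idm : forall x, hom x x;
  compm : forall x y z, hom x y -> hom y z -> hom x z;
  compmA : forall x y z t (f : hom x y) (g : hom y z) (h : hom z t),
    compm f (compm g h) = compm (compm f g) h;
  comp1m : forall x y (f : hom x y), compm (idm x) f = f;
  compm1 : forall x y (f : hom x y), compm f (idm y) = f }.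

Record functor (C D : category) := Functor {
  fob : ob C -> ob D;
  fhom : forall x y, hom x y -> hom (fob x) (fob y);
  fhom1 : forall x, fhom (idm x) = idm (fob x);
  fhomM : forall x y z (f : hom x y) (g : hom y z),
    fhom (compm f g) = compm (fhom f) (fhom g) }.

Definition isomorphic (C D : category) : Prop :=
  exists F : functor C D,
    bijective (fob F) /\ forall x y, bijective (@fhom _ _ F x y).

Definition monoid_category (M : monoidType) : category :=
  @Category unit (fun _ _ => M) (fun _ => 1) (fun _ _ _ f g => f * g)
    (fun _ _ _ _ f g h => mulgA f g h) (fun _ _ f => mul1g f)
    (fun _ _ f => mulg1 f).

Section Paths.
Context {V : Type} {E : V -> V -> Type}.

Inductive gpath : V -> V -> Type :=
| pnil x : gpath x x
| pcons x y z : E x y -> gpath y z -> gpath x z.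

Fixpoint pcat x y z (p : gpath x y) : gpath y z -> gpath x z :=
  match p in gpath x y return gpath y z -> gpath x z with
  | pnil _ => fun q => q
  | pcons _ _ _ a p' => fun q => pcons a (pcat p' q)
  end.

Lemma pcatA x y z t (p : gpath x y) (q : gpath y z) (r : gpath z t) :
  pcat p (pcat q r) = pcat (pcat p q) r.
Proof. by elim: p q => //= a b c e p IH q; rewrite IH. Qed.

Lemma pcat0 x y (p : gpath x y) : pcat p (pnil y) = p.
Proof. by elim: p => //= a b c e p ->. Qed.

HB.instance Definition _ x y := gen_eqMixin (gpath x y).
HB.instance Definition _ x y := gen_choiceMixin (gpath x y).

End Paths.
Arguments gpath {V} E.
Arguments pnil {V E}.

Local Notation "p ** q" := (pcat p q) (at level 40, left associativity).

Record polygraph2 := Polygraph2 {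
  cell0 : Type;
  cell1 : cell0 -> cell0 -> Type;
  cell2 : forall x y, gpath cell1 x y -> gpath cell1 x y -> Type }.

Section FreeCells.
Variable P : polygraph2.
Local Notation gpath := (gpath (@cell1 P)).

Inductive congruent : forall x y, gpath x y -> gpath x y -> Prop :=
| cg_gen x y (p q : gpath x y) : cell2 p q -> congruent p q
| cg_refl x y (p : gpath x y) : congruent p p
| cg_sym x y (p q : gpath x y) : congruent p q -> congruent q p
| cg_trans x y (p q r : gpath x y) :
    congruent p q -> congruent q r -> congruent p r
| cg_cat x y z (p p' : gpath x y) (q q' : gpath y z) :
    congruent p p' -> congruent q q' -> congruent (p ** q) (p' ** q').

(* Formal composites of generating 2-cells and their inverses.  The 2-cells
   of the free (2,1)-category are these terms up to [cell2_eq] below, taken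
   with no generating 3-cell. *)
Inductive tcell : forall x y, gpath x y -> gpath x y -> Type :=
| tgen x y (p q : gpath x y) : cell2 p q -> tcell p q
| tid x y (p : gpath x y) : tcell p p
| tinv x y (p q : gpath x y) : tcell p q -> tcell q p
| tcomp1 x y (p q r : gpath x y) : tcell p q -> tcell q r -> tcell p r
| tcomp0 x y z (p q : gpath x y) (p' q' : gpath y z) :
    tcell p q -> tcell p' q' -> tcell (p ** p') (q ** q').

End FreeCells.

Local Notation "f \*1 g" := (tcomp1 f g) (at level 50, left associativity).
Local Notation "f \*0 g" := (tcomp0 f g) (at level 40, left associativity).

Section PresentedCategory.
Variable P : polygraph2.
Local Notation gpath := (gpath (@cell1 P)).
Implicit Types x y z t : cell0 P.

Definition congruentb x y (p q : gpath x y) : bool := `[< congruent p q >].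

Lemma congruentb_refl x y : reflexive (@congruentb x y).
Proof. by move=> p; apply/asboolP/cg_refl. Qed.

Lemma congruentb_sym x y : symmetric (@congruentb x y).
Proof. by move=> p q; apply/asboolP/asboolP; apply: cg_sym. Qed.

Lemma congruentb_trans x y : transitive (@congruentb x y).
Proof.
by move=> q p r /asboolP pq /asboolP qr; apply/asboolP; apply: cg_trans pq qr.
Qed.

Canonical congruent_equiv x y :=
  EquivRel (@congruentb x y) (@congruentb_refl x y) (@congruentb_sym x y)
    (@congruentb_trans x y).

Definition phom x y : Type := {eq_quot (congruent_equiv x y)}.

Definition pclass x y (p : gpath x y) : phom x y :=
  \pi_({eq_quot (congruent_equiv x y)})%qT p.

Definition prepr x y (f : phom x y) : gpath x y :=
  repr (f : {eq_quot (congruent_equiv x y)}).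

Lemma preprK x y (f : phom x y) : pclass (prepr f) = f.
Proof. exact: reprK. Qed.

Lemma pclassP x y (p q : gpath x y) : pclass p = pclass q <-> congruent p q.
Proof.
split=> [/eqmodP/asboolP //|pq]; exact/eqmodP/asboolP.
Qed.

Lemma prepr_class x y (p : gpath x y) : congruent (prepr (pclass p)) p.
Proof. by apply/pclassP; rewrite preprK. Qed.

Definition pcomp x y z (f : phom x y) (g : phom y z) : phom x z :=
  pclass (prepr f ** prepr g).

Lemma pcompE x y z (p : gpath x y) (q : gpath y z) :
  pcomp (pclass p) (pclass q) = pclass (p ** q).
Proof. by apply/pclassP; apply: cg_cat; apply: prepr_class. Qed.

Lemma pcompA x y z t (f : phom x y) (g : phom y z) (h : phom z t) :
  pcomp f (pcomp g h) = pcomp (pcomp f g) h.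
Proof.
by rewrite -(preprK f) -(preprK g) -(preprK h) !pcompE pcatA.
Qed.

Lemma pcomp1f x y (f : phom x y) : pcomp (pclass (pnil x)) f = f.
Proof. by rewrite -(preprK f) pcompE. Qed.

Lemma pcompf1 x y (f : phom x y) : pcomp f (pclass (pnil y)) = f.
Proof. by rewrite -(preprK f) pcompE pcat0. Qed.

Definition presented_category : category :=
  Category pcompA pcomp1f pcompf1.

End PresentedCategory.

(* The boundary of a generating 3-cell is a pair of parallel 2-cells of the
   free (2,1)-category, given by representatives. *)
Record polygraph31 := Polygraph31 {
  base2 : polygraph2;
  cell3 : forall x y (p q : gpath (@cell1 base2) x y),
    tcell p q -> tcell p q -> Type }.

(* Equality of 2-cells in the (2,1)-category presented by [P]: the congruence
   generated by the axioms of (2,1)-categories and by the 3-cells, where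
   [\*1] and [\*0] are composition along 1-cells and 0-cells.  It is
   heterogeneous because associativity and unitality of [pcat] are not
   definitional; see [cell2_eq_parallel]. *)
Section Cell2Eq.
Variable P : polygraph31.
Local Notation gpath := (gpath (@cell1 (base2 P))).

Inductive cell2_eq : forall x y (p q p' q' : gpath x y),
    tcell p q -> tcell p' q' -> Prop :=
| e_cell3 x y (p q : gpath x y) (f g : tcell p q) : cell3 f g -> cell2_eq f g
| e_refl x y (p q : gpath x y) (f : tcell p q) : cell2_eq f f
| e_sym x y (p q p' q' : gpath x y) (f : tcell p q) (g : tcell p' q') :
    cell2_eq f g -> cell2_eq g f
| e_trans x y (p q p' q' p'' q'' : gpath x y)
    (f : tcell p q) (g : tcell p' q') (h : tcell p'' q'') :
    cell2_eq f g -> cell2_eq g h -> cell2_eq f h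
| e_inv x y (p q p' q' : gpath x y) (f : tcell p q) (f' : tcell p' q') :
    cell2_eq f f' -> cell2_eq (tinv f) (tinv f')
| e_comp1 x y (p q r p' q' r' : gpath x y) (f : tcell p q) (g : tcell q r)
    (f' : tcell p' q') (g' : tcell q' r') :
    cell2_eq f f' -> cell2_eq g g' -> cell2_eq (f \*1 g) (f' \*1 g')
| e_comp0 x y z (p q p' q' : gpath x y) (r s r' s' : gpath y z)
    (f : tcell p q) (g : tcell r s) (f' : tcell p' q') (g' : tcell r' s') :
    cell2_eq f f' -> cell2_eq g g' -> cell2_eq (f \*0 g) (f' \*0 g')
| e_comp1A x y (p q r s : gpath x y)
    (f : tcell p q) (g : tcell q r) (h : tcell r s) :
    cell2_eq (f \*1 (g \*1 h)) (f \*1 g \*1 h)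
| e_comp1_idl x y (p q : gpath x y) (f : tcell p q) :
    cell2_eq (tid p \*1 f) f
| e_comp1_idr x y (p q : gpath x y) (f : tcell p q) :
    cell2_eq (f \*1 tid q) f
| e_invr x y (p q : gpath x y) (f : tcell p q) :
    cell2_eq (f \*1 tinv f) (tid p)
| e_invl x y (p q : gpath x y) (f : tcell p q) :
    cell2_eq (tinv f \*1 f) (tid q)
| e_comp0A x y z t (p q : gpath x y) (p' q' : gpath y z) (p'' q'' : gpath z t)
    (f : tcell p q) (g : tcell p' q') (h : tcell p'' q'') :
    cell2_eq (f \*0 (g \*0 h)) (f \*0 g \*0 h)
| e_comp0_idl x y (p q : gpath x y) (f : tcell p q) :
    cell2_eq (tid (pnil x) \*0 f) f
| e_comp0_idr x y (p q : gpath x y) (f : tcell p q) :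
    cell2_eq (f \*0 tid (pnil y)) f
| e_comp0_id x y z (p : gpath x y) (q : gpath y z) :
    cell2_eq (tid p \*0 tid q) (tid (p ** q))
| e_exchange x y z (p q r : gpath x y) (p' q' r' : gpath y z)
    (f : tcell p q) (g : tcell q r) (f' : tcell p' q') (g' : tcell q' r') :
    cell2_eq ((f \*1 g) \*0 (f' \*1 g')) ((f \*0 f') \*1 (g \*0 g')).

Lemma cell2_eq_parallel x y (p q p' q' : gpath x y)
    (f : tcell p q) (g : tcell p' q') :
  cell2_eq f g -> p = p' /\ q = q'.
Proof.
by elim=> {x y p q p' q' f g} //=;
  do ?[move=> *; rewrite ?pcatA ?pcat0; intuition congruence].
Qed.

Definition homotopy_basis : Prop :=
  forall x y (p q : gpath x y) (f g : tcell p q), cell2_eq f g.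

End Cell2Eq.

Definition coherent_presentation (P : polygraph31) (C : category) : Prop :=
  isomorphic (presented_category (base2 P)) C /\ homotopy_basis P.

Section PresentedMonoid.
Variables (A : choiceType) (R : seq A -> seq A -> Prop).

Inductive mcongruent : seq A -> seq A -> Prop :=
| mc_gen a b : R a b -> mcongruent a b
| mc_refl a : mcongruent a a
| mc_sym a b : mcongruent a b -> mcongruent b a
| mc_trans a b c : mcongruent a b -> mcongruent b c -> mcongruent a c
| mc_cat a a' b b' :
    mcongruent a a' -> mcongruent b b' -> mcongruent (a ++ b) (a' ++ b').

Definition mcongruentb a b : bool := `[< mcongruent a b >].

Lemma mcongruentb_refl : reflexive mcongruentb.
Proof. by move=> a; apply/asboolP/mc_refl. Qed.

Lemma mcongruentb_sym : symmetric mcongruentb.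
Proof. by move=> a b; apply/asboolP/asboolP; apply: mc_sym. Qed.

Lemma mcongruentb_trans : transitive mcongruentb.
Proof.
by move=> b a c /asboolP ab /asboolP bc; apply/asboolP; apply: mc_trans ab bc.
Qed.

Canonical mcongruent_equiv :=
  EquivRel mcongruentb mcongruentb_refl mcongruentb_sym mcongruentb_trans.

Definition presented_monoid : Type := {eq_quot mcongruent_equiv}.

HB.instance Definition _ := Choice.on presented_monoid.

Definition mclass (a : seq A) : presented_monoid :=
  \pi_({eq_quot mcongruent_equiv})%qT a.

Definition mrepr (x : presented_monoid) : seq A :=
  repr (x : {eq_quot mcongruent_equiv}).

Lemma mreprK x : mclass (mrepr x) = x.
Proof. exact: reprK. Qed.

Lemma mclassP a b : mclass a = mclass b <-> mcongruent a b.
Proof.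
split=> [/eqmodP/asboolP //|ab]; exact/eqmodP/asboolP.
Qed.

Lemma mrepr_class a : mcongruent (mrepr (mclass a)) a.
Proof. by apply/mclassP; rewrite mreprK. Qed.

Definition pm_mul (x y : presented_monoid) : presented_monoid :=
  mclass (mrepr x ++ mrepr y).

Lemma pm_mulE a b : pm_mul (mclass a) (mclass b) = mclass (a ++ b).
Proof. by apply/mclassP; apply: mc_cat; apply: mrepr_class. Qed.

Lemma pm_mulA : associative pm_mul.
Proof.
by move=> x y z; rewrite -(mreprK x) -(mreprK y) -(mreprK z) !pm_mulE catA.
Qed.

Lemma pm_mul1x : left_id (mclass [::]) pm_mul.
Proof. by move=> x; rewrite -(mreprK x) pm_mulE. Qed.

Lemma pm_mulx1 : right_id (mclass [::]) pm_mul.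
Proof. by move=> x; rewrite -(mreprK x) pm_mulE cats0. Qed.

HB.instance Definition _ :=
  isMonoid.Build presented_monoid pm_mulA pm_mul1x pm_mulx1.

End PresentedMonoid.

Section CoxeterMatrix.
Context {d : Order.disp_t} {S : finOrderType d}.
(* [m s t = None] stands for m_st = infinity. *)
Variable m : S -> S -> option nat.

Definition coxeter_matrix : Prop :=
  [/\ forall s t, m s t = m t s,
      forall s t, m s t = Some 1%N <-> s = t
    & forall s t, m s t <> Some 0%N].

Definition coxeter_relations (G : groupType) (f : S -> G) : Prop :=
  forall s t n, m s t = Some n -> (f s * f t) ^+ n = 1.

(* [W] is the group presented by the generators [S] and the relations above:
   [gen] is universal among the maps to groups satisfying them. *)
Definition coxeter_group (W : groupType) (gen : S -> W) : Prop :=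
  [/\ coxeter_matrix, coxeter_relations gen
    & forall (G : groupType) (f : S -> G), coxeter_relations f ->
        exists! h : W -> G, monoid_morphism h /\ forall s, h (gen s) = f s].

Fixpoint alt (s t : S) (n : nat) : seq S :=
  if n is n'.+1 then s :: alt t s n' else [::].

Inductive artin_relation : seq S -> seq S -> Prop :=
| ArtinRelation s t n : s != t -> m s t = Some n ->
    artin_relation (alt s t n) (alt t s n).

Definition artin_monoid : monoidType := presented_monoid artin_relation.

Definition art1 (_ _ : unit) : Type := S.

Definition word (w : seq S) : gpath art1 tt tt :=
  foldr (fun s p => @pcons _ art1 tt tt tt s p) (pnil tt) w.

Inductive art2_cell : forall x y, gpath art1 x y -> gpath art1 x y -> Type :=
| Gamma s t n : (s < t)%O -> m s t = Some n ->
    @art2_cell tt tt (word (alt t s n)) (word (alt s t n)).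

Definition Art2 : polygraph2 := Polygraph2 art2_cell.

Definition gamma s t n (lst : (s < t)%O) (mst : m s t = Some n) :
    @tcell Art2 tt tt (word (alt t s n)) (word (alt s t n)) :=
  @tgen Art2 _ _ _ _ (Gamma lst mst).

End CoxeterMatrix.

Section Length.
Context {d : Order.disp_t} {S : finOrderType d} {W : groupType}.
Variable gen : S -> W.

Definition has_word (u : W) (n : nat) : bool :=
  [exists w : n.-tuple S, \prod_(s <- w) gen s == u].

(* The default value 0 is never used when [gen] is a Coxeter group, as all
   elements then are products of generators. *)
Definition len (u : W) : nat :=
  if pselect (exists n, has_word u n) is left ex_n then ex_minn ex_n else 0.

(* The complement of [u] in [v] can only be [u^-1 * v]. *)
Definition compl (u v : W) : W := u^-1 * v.

Definition divides (u v : W) : bool := len v == (len u + len (compl u v))%N.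

(* [first_gen u = Some s] means d_u = s; [first_gen 1 = None]. *)
Definition first_gen (u : W) : option S :=
  [pick s | divides (gen s) u
            && [forall t, divides (gen t) u ==> (s <= t)%O]].

Definition is_subgroup (H : set W) : Prop :=
  [/\ H 1, forall x y, H x -> H y -> H (x * y) & forall x, H x -> H x^-1].

Definition parabolic (I : {set S}) : set W :=
  smallest is_subgroup [set gen s | s in [set s | s \in I]].

(* The default value 1 is never used when [parabolic I] is finite. *)
Definition w0 (I : {set S}) : W :=
  xget 1 [set w | parabolic I w /\
                  forall u, parabolic I u -> (len u <= len w)%N].

(* [len u] recursive calls suffice, since each one decreases the length. *)
Fixpoint pi_rec (n : nat) (u : W) : seq S :=
  if n is n'.+1 then
    if [pick s | u == gen s] is Some s then [:: s]
    else if first_gen u is Some s then s :: pi_rec n' (compl (gen s) u)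
    else [::]
  else [::].

Definition pi_ (u : W) : gpath art1 tt tt := word (pi_rec (len u) u).

End Length.

Section Art3.
Context {d : Order.disp_t} {S : finOrderType d} {W : groupType}.
Variables (m : S -> S -> option nat) (gen : S -> W).

Local Notation tcell := (@tcell (Art2 m) tt tt).
Local Notation "''pi' u" := (pi_ gen u) (at level 8, u at level 2).
Local Notation letter s := (word [:: s]).
Local Notation idc p := (@tid (Art2 m) tt tt p).

Definition cell_cast (p q p' q' : gpath art1 tt tt) (ep : p = p') (eq : q = q')
    (f : tcell p q) : tcell p' q' :=
  let: erefl := ep in let: erefl := eq in f.

Local Notation "f \*1 [ e ] g" := (f \*1 cell_cast e erefl g)
  (at level 50, left associativity).

(* [pi_alpha u v f] holds when [f] is pi(alpha_(u,v)), following the recursive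
   definition of the latter, for u, v <> 1 with l(uv) = l(u) + l(v).  All the
   equality proofs only serve to identify 1-cells that are equal, but not by
   definition. *)
Inductive pi_alpha :
  forall u v : W, tcell ('pi u ** 'pi v) ('pi (u * v)) -> Prop :=
| alpha_split u v s (u' := compl (gen s) u)
    (f : tcell ('pi u' ** 'pi v) ('pi (u' * v)))
    (g : tcell ('pi (gen s) ** 'pi (u' * v)) ('pi (gen s * (u' * v)))) e e1 e2 :
    (forall t, u <> gen t) -> first_gen gen u = Some s ->
    pi_alpha f -> pi_alpha g ->
    @pi_alpha u v (cell_cast e1 e2 (idc (letter s) \*0 f \*1 [e] g))
| alpha_id s v e :
    first_gen gen (gen s * v) = Some s ->
    @pi_alpha (gen s) v (cell_cast e erefl (idc ('pi (gen s * v))))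
| alpha_gamma s v r n (lrs : (r < s)%O) (mrs : m r s = Some n) e1 e2 :
    first_gen gen (gen s * v) = Some r ->
    gen s * v = w0 gen [set r; s]%SET ->
    @pi_alpha (gen s) v (cell_cast e1 e2 (gamma lrs mrs))
| alpha_gen s v r n (lrs : (r < s)%O) (mrs : m r s = Some n)
    (x := compl (gen s) (w0 gen [set r; s]%SET)) (y := compl x v)
    (f : tcell ('pi x ** 'pi y) ('pi (x * y)))
    (g : tcell ('pi (gen s * x) ** 'pi y) ('pi (gen s * x * y))) e e' e1 e2 :
    first_gen gen (gen s * v) = Some r ->
    gen s * v <> w0 gen [set r; s]%SET ->
    pi_alpha f -> pi_alpha g ->
    @pi_alpha (gen s) v
      (cell_cast e1 e2 (idc (letter s) \*0 tinv f
                    \*1 [e] (gamma lrs mrs \*0 idc ('pi y))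
                    \*1 [e'] g)).

(* As [pi_alpha u v] holds for a single 2-cell, and equality proofs between
   1-cells are unique, there is one 3-cell for each triple r < s < t with
   [parabolic gen [set r; s; t]] finite, the existence of a finite [n] being
   then a consequence. *)
Inductive art3_cell : forall x y (p q : gpath (@cell1 (Art2 m)) x y),
    Defs.tcell p q -> Defs.tcell p q -> Type :=
| Zcell r s t n (lrs : (r < s)%O) (lst : (s < t)%O) (mst : m s t = Some n)
    (u := compl (gen t) (w0 gen [set s; t]%SET))
    (v := compl (w0 gen [set s; t]%SET) (w0 gen [set r; s; t]%SET))
    (f : tcell ('pi (gen t * u) ** 'pi v) ('pi (gen t * u * v)))
    (g : tcell ('pi u ** 'pi v) ('pi (u * v)))
    (h : tcell ('pi (gen t) ** 'pi (u * v)) ('pi (gen t * (u * v))))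
    e e' e1 e2 :
    finite_set (parabolic gen [set r; s; t]%SET) ->
    pi_alpha f -> pi_alpha g -> pi_alpha h ->
    art3_cell (gamma lst mst \*0 idc ('pi v) \*1 [e] f)
              (cell_cast e1 e2 (idc (letter t) \*0 g \*1 [e'] h)).

Definition Art3 : polygraph31 := Polygraph31 art3_cell.

End Art3.

(* Main.v *)
From HB Require Import structures.
Require Import Defs.
From mathcomp Require Import all_boot all_order.
From mathcomp Require Import all_algebra all_field zify ring.
From mathcomp Require Import boolp classical_sets cardinality.
From Stdlib Require Import Setoid Morphisms.

(* Braid moves preserve the length of words, so coherence is proved by induction
   on the length n of the source. By induction, parallel 2-cells between words
   of the form [s p] that leave the first letter alone are equal, and two moves
   that replace the first letter [s] by [t] differ by such 2-cells, because the
   Artin monoid is left cancellative and every common multiple of [s] and [t] is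
   a multiple of their lcm. The 2-cells between the words of a given element
   thus amount to the fundamental groupoid of the complete graph on the letters
   dividing it, and it remains to fill the triangles. If [r], [s] and [t] divide
   an element, then W_{r,s,t} is finite and the lift of its longest element
   divides it too; unfolding the definition of pi(alpha), both sides of
   Z_{r,s,t} change the first letter only by t => s => r and by t => r, so that
   Z_{r,s,t} is exactly the missing triangle.

   The divisibility properties of the Artin monoid follow Michel: the greatest
   prefix of a word that lifts an element of W is well defined, since
   (u, v) |-> u * max {v' <= v | u v' reduced} is an action of the Artin monoid
   on the set W. *)

Set Implicit Arguments.
Unset Strict Implicit.
Unset Printing Implicit Defensive.

Local Open Scope group_scope.

(** [W] is known only through its universal property, and it may be infinite. What is not a formal
    consequence of the relations is therefore read off from homomorphisms into groups of bijections:
    generation by [gen], the exchange condition (a parity attached to each reflection), and the fact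
    that the order of [gen s * gen t] is not smaller than [m s t] (a geometric representation).
    Longest elements are available only below a given element: a common multiple of the letters of
    [I] bounds the lengths in W_I.

    For 2-cells, the claim carried through the induction is that every 2-cell out of a nonempty word
    is [direct]. Direct cells with given ends are unique, so this gives coherence, and only
    composites through three distinct letters call for a 3-cell. A 3-cell treats one order of the
    letters, the decreasing one; the other five follow by inverting and by solving a triangle for
    one of its sides. As [pi_alpha] is a relation, its cells must be shown to exist, which is done
    together with their directness. *)

Record bijection (X : Type) := Bijection {
  bij_fun :> X -> X;
  bij_inv : X -> X;
  bij_funK : cancel bij_fun bij_inv;
  bij_invK : cancel bij_inv bij_fun }.

(** * The group of bijections of a type *)

Section BijectionGroup.
Variable X : Type.
Implicit Types f g h : bijection X.

HB.instance Definition _ := gen_eqMixin (bijection X).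
HB.instance Definition _ := gen_choiceMixin (bijection X).

Lemma bijectionP f g : f =1 g -> f = g.
Proof.
case: f g => [f f' fK f'K] [g g' gK g'K] /= /funext fg; subst g.
have fg' : f' = g' by apply/funext => x; rewrite -{1}(g'K x) fK.
by subst g'; congr Bijection; apply: Prop_irrelevance.
Qed.

Definition bij_one : bijection X := @Bijection X id id (fun=> erefl) (fun=> erefl).
Definition bij_mul f g : bijection X :=
  Bijection (can_comp (bij_funK f) (bij_funK g))
            (can_comp (bij_invK g) (bij_invK f)).
Definition bij_opp f : bijection X := Bijection (bij_invK f) (bij_funK f).

Lemma bij_mulA : associative bij_mul.
Proof. by move=> f g h; apply: bijectionP. Qed.
Lemma bij_mul1f : left_id bij_one bij_mul.
Proof. by move=> f; apply: bijectionP. Qed.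
Lemma bij_mulf1 : right_id bij_one bij_mul.
Proof. by move=> f; apply: bijectionP. Qed.
Lemma bij_mulVf : left_inverse bij_one bij_opp bij_mul.
Proof. by move=> f; apply: bijectionP => x /=; rewrite bij_funK. Qed.
Lemma bij_mulfV : right_inverse bij_one bij_opp bij_mul.
Proof. by move=> f; apply: bijectionP => x /=; rewrite bij_invK. Qed.

HB.instance Definition _ := isGroup.Build (bijection X)
  bij_mulA bij_mul1f bij_mulf1 bij_mulVf bij_mulfV.

Lemma bijM f g x : (f * g) x = f (g x). Proof. by []. Qed.
Lemma bij1 x : (1 : bijection X) x = x. Proof. by []. Qed.

End BijectionGroup.

(** * Alternating words *)

Section Alternating.
Context {d : Order.disp_t} {S : finOrderType d}.
Implicit Types (s t : S) (n : nat).

Lemma size_alt s t n : size (alt s t n) = n.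
Proof. by elim: n s t => //= n IH s t; rewrite IH. Qed.

Lemma altD s t n k :
  alt s t (n + k) = alt s t n ++ (if odd n then alt t s k else alt s t k).
Proof. by elim: n s t => //= n IH s t; rewrite IH; case: (odd n). Qed.

Lemma rev_alt_double s t n : rev (alt s t n.*2) = alt t s n.*2.
Proof.
elim: n => // n IH; rewrite doubleS -addn2 {1}altD odd_double rev_cat IH /=.
by rewrite -[2]/(size [:: t; s]) addnC altD.
Qed.

Lemma prod_alt_double (M : monoidType) (f : S -> M) s t n :
  \prod_(x <- alt s t n.*2) f x = (f s * f t) ^+ n.
Proof.
elim: n => [|n IH]; first by rewrite big_nil expg0.
by rewrite doubleS /= !big_cons IH expgS mulgA.
Qed.

End Alternating.

(** * Reflections and reduced expressions *)

Section Reflections.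
Context {d : Order.disp_t} {S : finOrderType d}.
Context {m : S -> S -> option nat} {W : groupType} {gen : S -> W}.
Hypothesis hW : coxeter_group m gen.
Implicit Types (s t : S) (n : nat) (u v w x y : W) (p q : seq S).

Local Notation wprod p := (\prod_(s <- p) gen s).

Lemma cox_sym s t : m s t = m t s.
Proof. by case: hW => -[]. Qed.

Lemma cox_diag s t : m s t = Some 1%N <-> s = t.
Proof. by case: hW => -[]. Qed.

Lemma cox_relation s t n : m s t = Some n -> (gen s * gen t) ^+ n = 1.
Proof. by case: hW => _ + _; apply. Qed.

Lemma cox_ge2 s t n : s != t -> m s t = Some n -> exists k, n = k.+2.
Proof.
move=> /eqP st; case: n => [|[|n]] mst; last by exists n.
  by case: hW => -[_ _ /(_ s t)].
by case: st; apply/cox_diag.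
Qed.

Lemma genK s : gen s * gen s = 1.
Proof. by rewrite -[LHS]expg1 (@cox_relation s s 1) //; apply/cox_diag. Qed.

Lemma genV s : (gen s)^-1 = gen s.
Proof. exact/mulg1_eq/genK. Qed.

Lemma genM s w : gen s * (gen s * w) = w.
Proof. by rewrite mulgA genK mul1g. Qed.

Lemma Mgen s w : w * gen s * gen s = w.
Proof. by rewrite -mulgA genK mulg1. Qed.

Lemma wprod_rev p : wprod (rev p) = (wprod p)^-1.
Proof.
elim: p => [|s p IH]; first by rewrite !big_nil invg1.
by rewrite rev_cons -cats1 big_cat big_cons big_nil IH /= big_cons mulg1 invgM genV.
Qed.

Let left_mul w : bijection (W * bool).
Proof.
exists (fun z => (w * z.1, z.2)) (fun z => (w^-1 * z.1, z.2)) => -[x b] /=.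
  by rewrite mulKg.
by rewrite mulVKg.
Defined.

(* Two homomorphisms from [W] to the bijections of [W * bool], left translation
   and its conjugate by the exchange of the two copies of the set of products
   of generators, agree on generators. *)
Lemma gen_span w : exists p, wprod p = w.
Proof.
pose H u := `[< exists p, wprod p = u >].
have HM s u : H (gen s * u) = H u.
  apply/asboolP/asboolP => -[p up]; exists (s :: p); rewrite big_cons up //.
  by rewrite genM.
have [swap swapE] : exists f : bijection (W * bool),
    forall z, f z = (z.1, H z.1 (+) z.2).
  have K : cancel (fun z : W * bool => (z.1, H z.1 (+) z.2))
                  (fun z => (z.1, H z.1 (+) z.2)).
    by move=> [x b] /=; rewrite addKb.
  by exists (Bijection K K).
have lM x y : left_mul (x * y) = left_mul x * left_mul y.
  by apply: bijectionP => -[z b]; rewrite bijM /= mulgA.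
have l1 : left_mul 1 = 1 by apply: bijectionP => -[z b]; rewrite /= mul1g.
have rel : coxeter_relations m (left_mul \o gen).
  move=> s t n /cox_relation st.
  have E k : (left_mul (gen s) * left_mul (gen t)) ^+ k
             = left_mul ((gen s * gen t) ^+ k).
    by elim: k => [|k IH]; rewrite ?expg0 // !expgS IH !lM.
  by rewrite /= E st.
have [h [_ hU]] := (let: And3 _ _ U := hW in U) _ _ rel.
have h1 : h = left_mul by apply: hU; do !split.
have h2 : h = fun w => swap * left_mul w * monoid.inv swap.
  apply: hU; split=> [|s /=].
    split=> [|x y]; first by rewrite l1 mulg1 mulgV.
    by rewrite lM !mulgA mulgVK.
  apply: (canLR (mulgK _)); apply: bijectionP => -[x b].
  by rewrite !bijM !swapE /= HM.
have := congr1 (fun f : W -> bijection _ => f w * swap) (esym h2).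
rewrite h1 /= mulgVK => /(congr1 (fun f : bijection _ => f (1, false))).
rewrite !bijM !swapE /= => -[].
have -> : H 1 by apply/asboolP; exists [::]; rewrite big_nil.
by rewrite mulg1 addbF => /asboolP.
Qed.

(** For the word s_1 ... s_k these are the reflections s_1 ... s_(i-1) s_i s_(i-1) ... s_1; when the
    word is reduced, they are the left inversions of its product. *)
Definition refls p : seq W :=
  foldr (fun s r => gen s :: [seq gen s * x * gen s | x <- r]) [::] p.

Lemma size_refls p : size (refls p) = size p.
Proof. by elim: p => //= s p IH; rewrite size_map IH. Qed.

Lemma count_conj s x r :
  count_mem x [seq gen s * y * gen s | y <- r] = count_mem (gen s * x * gen s) r.
Proof.
rewrite count_map; apply: eq_count => y /=.
apply/eqP/eqP => [<-|->]; by rewrite !mulgA genK mul1g Mgen.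
Qed.

Lemma conj_genK s x : gen s * (gen s * x * gen s) * gen s = x.
Proof. by rewrite !mulgA genK mul1g Mgen. Qed.

Lemma mem_conj s x r :
  (x \in [seq gen s * y * gen s | y <- r]) = (gen s * x * gen s \in r).
Proof. by rewrite -!has_pred1 !has_count count_conj. Qed.

Lemma refls_cat p q :
  refls (p ++ q) = refls p ++ [seq wprod p * x * (wprod p)^-1 | x <- refls q].
Proof.
elim: p => [|s p IH] /=.
  by rewrite big_nil invg1 -[LHS]map_id; apply: eq_map => x; rewrite mul1g mulg1.
congr (_ :: _); rewrite IH map_cat big_cons; congr (_ ++ _).
by rewrite -map_comp; apply: eq_map => x /=; rewrite invgM genV !mulgA.
Qed.

Lemma refls_alt s t n :
  refls (alt s t n) = mkseq (fun i => (gen s * gen t) ^+ i * gen s) n.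
Proof.
elim: n s t => //= n IH s t; rewrite IH /mkseq /= expg0 mul1g; congr (_ :: _).
rewrite -map_comp -(addn0 1%N) iotaDl -map_comp; apply: eq_map => i /=.
rewrite add1n expgSr.
have E : gen s * (gen t * gen s) ^+ i = (gen s * gen t) ^+ i * gen s.
  elim: i => [|i IHi]; first by rewrite !expg0 mul1g mulg1.
  by rewrite expgSr mulgA IHi expgSr !mulgA.
by rewrite !mulgA E.
Qed.

(** The classical action on signed reflections, extended from the reflections to all of [W], so that
    no type of reflections is required. *)
Let reflb_fun s (z : W * bool) := (gen s * z.1 * gen s, z.2 (+) (z.1 == gen s)).

Let reflb_funK s : cancel (reflb_fun s) (reflb_fun s).
Proof.
move=> [x b]; rewrite /reflb_fun /= conj_genK.
suff -> : (gen s * x * gen s == gen s) = (x == gen s) by rewrite addbK.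
apply/eqP/eqP => [h|->]; last by rewrite genK mul1g.
by rewrite -(conj_genK s x) h genK mul1g.
Qed.

Let reflb s : bijection (W * bool) := Bijection (reflb_funK s) (reflb_funK s).

Let reflbE s x b : reflb s (x, b) = (gen s * x * gen s, b (+) (x == gen s)).
Proof. by []. Qed.

Lemma prod_reflb p x b :
  (\prod_(s <- rev p) reflb s) (x, b)
  = ((wprod p)^-1 * x * wprod p, b (+) odd (count_mem x (refls p))).
Proof.
elim: p x b => [|s p IH] x b /=.
  by rewrite !big_nil bij1 invg1 mul1g mulg1 addbF.
have -> : \prod_(t <- rev (s :: p)) reflb t = \prod_(t <- rev p) reflb t * reflb s.
  by rewrite rev_cons -cats1 big_cat big_seq1.
rewrite bijM reflbE IH big_cons invgM genV count_conj oddD oddb !mulgA.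
by rewrite addbA [gen s == x]eq_sym.
Qed.

(* The parity of the number of occurrences of a reflection is a cocycle on [W],
   because [W] acts on [W * bool] through [reflb]. *)
Lemma odd_refls p q x : wprod p = wprod q ->
  odd (count_mem x (refls p)) = odd (count_mem x (refls q)).
Proof.
have rel : coxeter_relations m reflb.
  move=> s t n mst; apply: bijectionP => -[y b].
  rewrite -prod_alt_double -rev_alt_double prod_reflb prod_alt_double.
  have ts : (gen t * gen s) ^+ n = 1 by apply: cox_relation; rewrite cox_sym.
  (* Since (ts)^n = 1, the 2n reflections of the alternating word are n reflections listed twice, so
     every parity is even. *)
  rewrite ts invg1 mul1g mulg1 refls_alt -addnn /mkseq iotaD add0n map_cat.
  have -> : iota n n = [seq (n + i)%N | i <- iota 0 n] by rewrite -iotaDl addn0.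
  rewrite -map_comp; under [X in _ ++ X]eq_map => i do rewrite /= expgnDr ts mul1g.
  by rewrite count_cat addnn odd_double addbF.
have [h [[[h1 hM] hg] _]] := (let: And3 _ _ U := hW in U) _ _ rel.
have hp r : h (wprod r) = \prod_(s <- r) reflb s.
  by elim: r => [|s r IH]; rewrite ?big_nil // !big_cons hM hg IH.
move=> pq; have := congr1 h (congr1 monoid.inv pq); rewrite -!wprod_rev !hp.
by move/(congr1 (fun f : bijection _ => (f (x, false)).2)); rewrite !prod_reflb.
Qed.

(** Multiplication by the i-th reflection cancels the i-th letter. *)
Lemma refls_delete p x : x \in refls p ->
  exists p1 s p2, [/\ p = p1 ++ s :: p2 & x * wprod p = wprod (p1 ++ p2)].
Proof.
elim: p x => //= s p IH x; rewrite in_cons => /orP[/eqP->|].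
  by exists [::], s, p; rewrite big_cons genM.
rewrite mem_conj => /IH[p1 [t [p2 [-> E]]]]; exists (s :: p1), t, p2; split=> //=.
by rewrite !big_cons -E !mulgA genK mul1g.
Qed.

(** The deletion condition: if the reflections at two places agree, applying [refls_delete] behind
    the first place removes both letters. *)
Lemma refls_dup p : ~~ uniq (refls p) ->
  exists p1 s p2 t p3, [/\ p = p1 ++ s :: p2 ++ t :: p3
                         & wprod p = wprod (p1 ++ p2 ++ p3)].
Proof.
elim: p => //= s p IH; rewrite negb_and negbK => /orP[|].
  rewrite mem_conj genK mul1g => /refls_delete[p1 [t [p2 [-> E]]]].
  by exists [::], s, p1, t, p2; rewrite big_cons.
rewrite map_inj_uniq; last by move=> x y /mulIg /mulgI.
move=> /IH[p1 [t [p2 [t' [p3 [-> E]]]]]]; exists (s :: p1), t, p2, t', p3.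
by rewrite !big_cons E.
Qed.

End Reflections.

(** * The order of the product of two generators *)

Section GeometricRepresentation.
Context {d : Order.disp_t} {S : finOrderType d}.
Context {m : S -> S -> option nat} {W : groupType} {gen : S -> W}.
Hypothesis hW : coxeter_group m gen.
Implicit Types (s t : S) (n : nat).

Import GRing.Theory.
Local Open Scope ring_scope.

(** The form [n.*2.-1.+1] of the order is positive by computation; it equals [n.*2] as soon as [n]
    is positive. *)
Let zeta n : algC := sval (@C_prim_root_exists n.*2.-1.+1 isT).

Let zetaP n : (0 < n)%N -> n.*2.-primitive_root (zeta n).
Proof.
by case: n => // n _; exact: (svalP (@C_prim_root_exists n.+1.*2.-1.+1 isT)).
Qed.

Let c s t : algC := if m s t is Some n then zeta n + (zeta n)^-1 else 2.

Let c_sym s t : c s t = c t s.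
Proof. by rewrite /c (cox_sym hW). Qed.

Let c_diag s : c s s = -2.
Proof.
rewrite /c (proj2 (cox_diag hW s s) erefl).
have z2 : 2.-primitive_root (zeta 1) by exact: (@zetaP 1).
have := prim_expr_order z2; rewrite -[RHS](expr1n _ 2) => /eqP.
rewrite eqf_sqr => /orP[/eqP z1|/eqP->].
  by have := prim_order_dvd z2 1; rewrite expr1 z1 eqxx.
by rewrite invrN1 -opprD.
Qed.

(* The action of the simple reflection [s] on the coordinates, with respect to
   the simple roots, of a linear form; [c s t] is a Galois conjugate of
   [2 cos (pi / m_st)]. *)
Let act_fun s (f : S -> algC) t : algC := f t + c s t * f s.

Let act_funK s : cancel (act_fun s) (act_fun s).
Proof. by move=> f; apply/funext => t; rewrite /act_fun c_diag; ring. Qed.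

Let act s : bijection (S -> algC) := Bijection (act_funK s) (act_funK s).

(** Each reflection reads one coordinate and adds a multiple of it. Here [x j] is the j-th value
    read when [act t] and [act s] alternate, starting with [act t]; these values obey a linear
    recurrence, and the form accumulates their sums. *)
Let act_iter s t (f : S -> algC) (x : nat -> algC) k :
    x 0 = f t -> x 1%N = f s + c t s * f t ->
    (forall j, x j.+2 = c t s * x j.+1 - x j) ->
  [/\ ((act s * act t) ^+ k)%g f = fun r => f r
        + c t r * (\sum_(j < k) x j.*2) + c s r * (\sum_(j < k) x j.*2.+1),
      ((act s * act t) ^+ k)%g f t = x k.*2
    & ((act s * act t) ^+ k)%g f s + c t s * ((act s * act t) ^+ k)%g f t
        = x k.*2.+1].
Proof.
move=> x0 x1 xS; elim: k => [|k [IH IHt IHs]].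
  rewrite expg0 bij1 x0 x1; split=> //.
  by apply/funext => r; rewrite !big_ord0 !mulr0 !addr0.
set h := ((act s * act t) ^+ k)%g f in IH IHt IHs *.
have E r : ((act s * act t) ^+ k.+1)%g f r = h r + c t r * x k.*2 + c s r * x k.*2.+1.
  by rewrite expgS !bijM -/h -IHt -IHs.
have Et : ((act s * act t) ^+ k.+1)%g f t = x k.*2.+2.
  by rewrite E xS IHt c_diag (c_sym s t); ring.
split.
- by apply/funext => r; rewrite E IH !big_ord_recr /=; ring.
- by rewrite Et.
- have hs : h s = x k.*2.+1 - c t s * x k.*2 by rewrite -IHs IHt addrK.
  by rewrite Et E hs doubleS [x k.*2.+3]xS c_diag; ring.
Qed.

(** For finite [m s t] the characteristic roots of the recurrence are [zeta n] and its inverse, so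
    its solutions are the combinations of their powers. *)
Let act_exp s t n j (A B : algC) (f : S -> algC) : s != t -> m s t = Some n ->
    A + B = f t -> A * zeta n + B / zeta n = f s + c t s * f t ->
  ((act s * act t) ^+ j)%g f = (fun r => f r
      + c t r * (\sum_(i < j) (A * zeta n ^+ i.*2 + B / zeta n ^+ i.*2))
      + c s r * (\sum_(i < j) (A * zeta n ^+ i.*2.+1 + B / zeta n ^+ i.*2.+1)))
  /\ ((act s * act t) ^+ j)%g f t = A * zeta n ^+ j.*2 + B / zeta n ^+ j.*2.
Proof.
move=> st mst AB1 AB2; have [k nk] := cox_ge2 hW st mst.
have zn : n.*2.-primitive_root (zeta n) by apply: zetaP; rewrite nk.
have z0 : zeta n != 0 by rewrite (prim_root_eq0 zn) nk.
have := @act_iter s t f (fun j => A * zeta n ^+ j + B / zeta n ^+ j) j.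
rewrite !expr0 !expr1 invr1 !mulr1 AB1 AB2 => /(_ erefl erefl) [] // i.
rewrite c_sym /c mst !exprS; field; by rewrite z0 expf_neq0.
Qed.

(** After [n] rounds the accumulated sums are geometric series of ratio [zeta n ^+ 2] or its
    inverse, a nontrivial n-th root of unity, and they vanish. *)
Let act_relations : coxeter_relations m act.
Proof.
move=> s t n mst; have [st|st] := eqVneq s t.
  have : m s t = Some 1%N by apply/(cox_diag hW).
  rewrite mst => -[->]; rewrite expg1 st; apply: bijectionP => f.
  exact: act_funK.
have [k nk] := cox_ge2 hW st mst.
have zn : n.*2.-primitive_root (zeta n) by apply: zetaP; rewrite nk.
have z0 : zeta n != 0 by rewrite (prim_root_eq0 zn) nk.
have z2 : zeta n ^+ 2 - 1 != 0.
  rewrite subr_eq0 -(prim_order_dvd zn) nk; apply/negP => /dvdn_leq.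
  by move/(_ isT).
apply: bijectionP => f; rewrite bij1.
pose w := f s + c t s * f t.
(* [A] solves the two linear equations on the initial values, with [B := f t - A]. *)
pose A := (w * zeta n - f t) / (zeta n ^+ 2 - 1).
have AB1 : A + (f t - A) = f t by ring.
have AB2 : A * zeta n + (f t - A) / zeta n = f s + c t s * f t.
  by rewrite -/w /A; field; rewrite z0 z2.
have [-> _] := act_exp n st mst AB1 AB2.
set B := f t - A.
have S0 : \sum_(i < n) (zeta n ^+ 2) ^+ i = 0.
  apply: (mulfI z2); rewrite mulr0 -subrX1 -exprM mul2n.
  by rewrite (prim_expr_order zn) subrr.
have S1 : \sum_(i < n) (zeta n ^+ 2)^-1 ^+ i = 0.
  have z2' : (zeta n ^+ 2)^-1 - 1 != 0.
    by rewrite subr_eq0 invr_eq1 -subr_eq0.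
  apply: (mulfI z2'); rewrite mulr0 -subrX1 exprVn -exprM mul2n.
  by rewrite (prim_expr_order zn) invr1 subrr.
apply/funext => r.
have -> : \sum_(i < n) (A * zeta n ^+ i.*2 + B / zeta n ^+ i.*2) = 0.
  under eq_bigr => i _ do rewrite -mul2n exprM -exprVn.
  by rewrite big_split /= -!mulr_sumr S0 S1 !mulr0 addr0.
have -> : \sum_(i < n) (A * zeta n ^+ i.*2.+1 + B / zeta n ^+ i.*2.+1) = 0.
  under eq_bigr => i _ do
    rewrite !exprS -mul2n exprM invfM -exprVn !mulrA.
  by rewrite big_split /= -!mulr_sumr S0 S1 !mulr0 addr0.
by rewrite !mulr0 !addr0.
Qed.

Lemma cox_order s t j : s != t -> (0 < j)%N ->
  (forall n, m s t = Some n -> (j < n)%N) -> ((gen s * gen t) ^+ j)%g <> 1%g.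
Proof.
move=> st j0 jn stj.
have [h [[[h1 hM] hg] _]] := (let: And3 _ _ U := hW in U) _ _ act_relations.
have {stj} actj f : ((act s * act t) ^+ j)%g f = f.
  rewrite -!hg -hM; have hX x i : h (x ^+ i)%g = (h x ^+ i)%g.
    by elim: i => [|i IH]; rewrite ?expg0 // !expgS hM IH.
  by rewrite -hX stj h1.
case mst: (m s t) => [n|].
  have [k nk] := cox_ge2 hW st mst.
  have zn : n.*2.-primitive_root (zeta n) by apply: zetaP; rewrite nk.
  (* Chosen so that the values read are exactly the powers of [zeta n]: the coordinate at [t] comes
     back to 1 after [j] rounds only if 2n divides 2j. *)
  pose f r : algC := if r == t then 1 else zeta n - c t s.
  have AB1 : 1 + 0 = f t by rewrite /f eqxx addr0.
  have AB2 : 1 * zeta n + 0 / zeta n = f s + c t s * f t.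
    by rewrite /f eqxx (negPf st); ring.
  have [_] := act_exp j st mst AB1 AB2.
  rewrite actj mul0r addr0 mul1r /f eqxx => /esym/eqP.
  rewrite -(prim_order_dvd zn) => /dvdn_leq; rewrite double_gt0 j0 => /(_ isT).
  by rewrite leq_double leqNgt jn.
(* For infinite [m s t] the recurrence has a double root 1; with these initial values the values
   read are 1, 2, 3, ..., so the coordinate at [t] never returns to 1. *)
pose f r : algC := if r == t then 1 else 0.
have cts : c t s = 2 by rewrite c_sym /c mst.
have [|||_ + _] := @act_iter s t f (fun j => j.+1%:R) j.
- by rewrite /f eqxx.
- by rewrite /f eqxx (negPf st) cts mulr1 add0r.
- by move=> i; rewrite cts -!natr1; ring.
rewrite actj /f eqxx => /eqP; rewrite -(subr_eq0 1) -natr1 opprD addrC.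
by rewrite addrNK oppr_eq0 Num.Theory.pnatr_eq0 double_eq0 => /eqP j00; rewrite j00 in j0.
Qed.

End GeometricRepresentation.

(* Versions of [mulgA] and [invgM] in which the products are those of the
   [groupType] structure, so that rewriting leaves syntactically equal terms. *)
Lemma mulWA (W : groupType) (x y z : W) : x * (y * z) = x * y * z.
Proof. exact: mulgA. Qed.

Lemma invWM (W : groupType) (x y : W) :
  (x * y)^-1 = ((y^-1 : W) * (x^-1 : W) : W).
Proof. exact: invgM. Qed.

(** * Length, divisibility, parabolic subgroups and longest elements *)

Section Length.
Context {d : Order.disp_t} {S : finOrderType d}.
Context {m : S -> S -> option nat} {W : groupType} {gen : S -> W}.
Hypothesis hW : coxeter_group m gen.
Implicit Types (s t : S) (n : nat) (u v w x y : W) (p q : seq S) (I : {set S}).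

Local Notation wprod p := (\prod_(s <- p) gen s).
Local Notation len := (len gen).
Local Notation refls := (@refls _ S W gen).

Lemma wprod_cat p q : wprod (p ++ q) = wprod p * wprod q.
Proof. exact: big_cat. Qed.

Lemma len_word w : exists2 p, wprod p = w & size p = len w.
Proof.
rewrite /Defs.len; case: pselect => [ex|[]].
  case: ex_minnP => n /existsP[p /eqP pw] _.
  by exists p; rewrite ?size_tuple.
have [p pw] := gen_span hW w; exists (size p).
by apply/existsP; exists (in_tuple p); rewrite /= pw.
Qed.

Lemma len_wprod p : len (wprod p) <= size p.
Proof.
rewrite /Defs.len; case: pselect => // ex; case: ex_minnP => n _; apply.
by apply/existsP; exists (in_tuple p).
Qed.

Definition reduced p := len (wprod p) == size p.

Lemma reducedP p : reflect (len (wprod p) = size p) (reduced p).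
Proof. exact: eqP. Qed.

Lemma reduced_word w : exists2 p, wprod p = w & reduced p.
Proof. by have [p pw sp] := len_word w; exists p; rewrite // /reduced pw sp. Qed.

(** A repetition lets two letters be deleted. Conversely, reflections that occur once occur with odd
    multiplicity in every word for the same element, which is then at least as long. *)
Lemma reducedE p : reduced p = uniq (refls p).
Proof.
apply/idP/idP => [|up].
  apply: contraLR => /(refls_dup hW)[p1 [s [p2 [t [p3 [-> E]]]]]].
  rewrite /reduced E neq_ltn; apply/orP; left.
  by apply: leq_ltn_trans (len_wprod _) _; rewrite !size_cat /= size_cat /=; lia.
have [q qp sq] := len_word (wprod p).
rewrite /reduced eqn_leq len_wprod -sq -(size_refls (gen := gen) q) -(size_refls (gen := gen) p).
apply: uniq_leq_size => // x xp; rewrite -has_pred1 has_count.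
have := odd_refls hW x qp; rewrite (count_uniq_mem x up) xp => oq.
by apply: odd_gt0; rewrite oq.
Qed.

Lemma lenM u v : len (u * v) <= len u + len v.
Proof.
have [p <- <-] := len_word u; have [q <- <-] := len_word v.
by rewrite -wprod_cat -size_cat len_wprod.
Qed.

Lemma len1 : len 1 = 0.
Proof. by have := len_wprod [::]; rewrite big_nil leqn0 => /eqP. Qed.

Lemma len_eq0 w : (len w == 0) = (w == 1).
Proof.
apply/eqP/eqP => [w0|->]; last exact: len1.
by have [p pw sp] := len_word w; rewrite -pw (size0nil (etrans sp w0)) big_nil.
Qed.

Lemma lenV w : len (monoid.inv w) = len w.
Proof.
suff H x : len (monoid.inv x) <= len x.
  by apply/eqP; rewrite eqn_leq H -{1}(invgK w) H.
have [p <- <-] := len_word x; rewrite -(wprod_rev hW).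
by rewrite -(size_rev p) len_wprod.
Qed.

Lemma len_gen s : len (gen s) = 1%N.
Proof.
have : reduced [:: s] by rewrite reducedE.
by rewrite /reduced big_seq1 => /eqP.
Qed.

Lemma gen_inj : injective gen.
Proof.
move=> s t st; apply/eqP/negPn/negP => ne.
apply: (@cox_order _ _ _ _ _ hW s t 1 ne); rewrite ?expg1 ?st ?(genK hW) // => n.
by move=> /(cox_ge2 hW ne)[k ->].
Qed.

Lemma reduced_cat p q : reduced (p ++ q) -> reduced p /\ reduced q.
Proof.
rewrite /reduced wprod_cat size_cat => /eqP E.
by move: (lenM (wprod p) (wprod q)) (len_wprod p) (len_wprod q); rewrite E; lia.
Qed.

Definition descent s w := len (gen s * w) < len w.

(** The product has a reduced word starting with [s], in which the reflection [gen s] occurs exactly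
    once; by parity it occurs in any other word. *)
Lemma descent_refls s p : descent s (wprod p) -> gen s \in refls p.
Proof.
move=> ds; have [q qp sq] := len_word (gen s * wprod p).
have sqp : wprod (s :: q) = wprod p by rewrite big_cons qp (genM hW).
have rq : reduced (s :: q).
  rewrite /reduced eqn_leq len_wprod sqp /= sq; exact: ds.
have := odd_refls hW (gen s) sqp; rewrite (count_uniq_mem _); last by rewrite -reducedE.
by rewrite mem_head => /esym; case E: (gen s \in _) => //; rewrite (count_memPn _) ?E.
Qed.

Lemma exchange s p : descent s (wprod p) ->
  exists p1 t p2, p = p1 ++ t :: p2 /\ gen s * wprod p = wprod (p1 ++ p2).
Proof.
by move=> /descent_refls/(refls_delete hW)[p1 [t [p2 [-> E]]]]; exists p1, t, p2.
Qed.

Lemma refls_descent s p : reduced p -> gen s \in refls p -> descent s (wprod p).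
Proof.
move=> /eqP rp /(refls_delete hW)[p1 [t [p2 [pE E]]]].
rewrite /descent rp E (leq_ltn_trans (len_wprod _)) // pE !size_cat /=; lia.
Qed.

Lemma reduced_cons s p :
  reduced (s :: p) = reduced p && ~~ descent s (wprod p).
Proof.
have [rp|nrp] := boolP (reduced p); last first.
  apply/negP => /(@reduced_cat [:: s]) [_ rp]; by rewrite rp in nrp.
rewrite reducedE /= (mem_conj hW) (genK hW) mul1g map_inj_uniq; last first.
  by move=> x y /mulIg /mulgI.
rewrite -reducedE rp andbT; congr (~~ _); apply/idP/idP; last exact: descent_refls.
exact: refls_descent.
Qed.

Lemma descentN s w : ~~ descent s w -> len (gen s * w) = (len w).+1.
Proof.
have [p <- rp] := reduced_word w => nd.
have : reduced (s :: p) by rewrite reduced_cons rp.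
by rewrite /reduced big_cons (eqP rp) => /eqP.
Qed.

Lemma descentY s w : descent s w -> len w = (len (gen s * w)).+1.
Proof.
move=> ds; rewrite -(@descentN s) ?(genM hW) // /descent (genM hW) -leqNgt.
exact: ltnW.
Qed.

Lemma descent_gen s w : descent s (gen s * w) = ~~ descent s w.
Proof.
rewrite [LHS]/descent (genM hW); case: (boolP (descent s w)) => ds.
  by rewrite ltnNge ltnW.
by rewrite (descentN ds) leqnn.
Qed.

Definition ladd u v := len (u * v) == len u + len v.

Lemma laddP u v : reflect (len (u * v) = len u + len v) (ladd u v).
Proof. exact: eqP. Qed.

Lemma dvd_ladd u v : divides gen u (u * v) = ladd u v.
Proof. by rewrite /divides /compl mulKg. Qed.

Lemma dvdP u v : reflect (exists2 v', v = u * v' & ladd u v') (divides gen u v).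
Proof.
apply: (iffP idP) => [|[v' -> uv']]; last by rewrite dvd_ladd.
by exists (compl u v); rewrite -?dvd_ladd /compl mulVKg.
Qed.

Lemma laddA u v w : ladd u v -> ladd (u * v) w = ladd u (v * w) && ladd v w.
Proof.
rewrite /ladd -mulWA => /eqP ->.
have := lenM u (v * w); have := lenM v w => vw uvw; apply/eqP/andP => [E|].
  by split; apply/eqP; lia.
by move=> [/eqP -> /eqP ->]; rewrite addnA.
Qed.

Lemma laddr u v w : ladd v w -> ladd u (v * w) = ladd (u * v) w && ladd u v.
Proof.
rewrite /ladd mulWA => /eqP ->.
have := lenM u v; have := lenM (u * v) w => uvw uv; apply/eqP/andP => [E|].
  by split; apply/eqP; lia.
by move=> [/eqP -> /eqP ->]; rewrite addnA.
Qed.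

Lemma laddV u v : ladd (monoid.inv u) (monoid.inv v) = ladd v u.
Proof. by rewrite /ladd -invWM !lenV addnC. Qed.

Lemma dvd_refl u : divides gen u u.
Proof. by rewrite -{2}(mulg1 u) dvd_ladd /ladd mulg1 len1 addn0. Qed.

Lemma dvd1 u : divides gen 1 u.
Proof. by rewrite -(mul1g u) dvd_ladd /ladd mul1g len1. Qed.

Lemma dvd_trans v u w : divides gen u v -> divides gen v w -> divides gen u w.
Proof.
move=> /dvdP[x -> ux] /dvdP[y -> ]; rewrite laddA // => /andP[xy _].
by rewrite -mulWA dvd_ladd.
Qed.

Lemma dvd_mull u v w : ladd u w -> divides gen v w ->
  ladd u v /\ divides gen (u * v) (u * w).
Proof.
move=> uw /dvdP[x wE vx]; move: uw; rewrite wE laddr // => /andP[uvx uv].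
by rewrite mulWA dvd_ladd.
Qed.

Lemma dvd_mulI u v w : ladd u v -> ladd u w ->
  divides gen (u * v) (u * w) = divides gen v w.
Proof.
rewrite /divides /ladd => /eqP -> /eqP ->.
by rewrite -addnA eqn_add2l /compl invWM -mulWA mulKg.
Qed.

Lemma dvd_leq u v : divides gen u v -> len u <= len v.
Proof. by rewrite /divides => /eqP ->; apply: leq_addr. Qed.

Lemma dvd_eq u v : divides gen u v -> len v <= len u -> v = u.
Proof.
move=> /dvdP[x -> /eqP ->]; rewrite -[X in _ <= X]addn0 leq_add2l leqn0 len_eq0.
by move=> /eqP ->; rewrite mulg1.
Qed.

Lemma ladd_gen s w : ladd (gen s) w = ~~ descent s w.
Proof.
rewrite /ladd len_gen add1n; case: (boolP (descent s w)) => ds /=; last first.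
  by rewrite (descentN ds) eqxx.
by apply/negbTE; move: ds; rewrite /descent; lia.
Qed.

Lemma dvd_gen s w : divides gen (gen s) w = descent s w.
Proof. by rewrite -{1}(genM hW s w) dvd_ladd ladd_gen descent_gen negbK. Qed.

Lemma descent_dvd s u v : descent s u -> divides gen u v -> descent s v.
Proof. by rewrite -!dvd_gen; apply: dvd_trans. Qed.

Lemma exists_descent w : w != 1 -> exists s, descent s w.
Proof.
have [[|s p] <- rp] := reduced_word w; first by rewrite big_nil eqxx.
exists s; rewrite big_cons descent_gen.
by move: rp; rewrite reduced_cons => /andP[].
Qed.

Lemma dvd_step u w : divides gen u w -> u != w ->
  exists s, ladd u (gen s) /\ divides gen (u * gen s) w.
Proof.
move=> /dvdP[x -> ux] ne; have [|s sx] := @exists_descent x.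
  by apply: contraNneq ne => ->; rewrite mulg1.
by exists s; apply: dvd_mull; rewrite ?dvd_gen.
Qed.

Lemma reduced_cat_ladd p q : reduced p -> reduced q ->
  reduced (p ++ q) = ladd (wprod p) (wprod q).
Proof.
by move=> /eqP rp /eqP rq; rewrite /reduced wprod_cat size_cat /ladd rp rq.
Qed.

(** Words over [I] are stable under deletion of letters, hence can be reduced inside [I];
    [parabolicE] identifies this with the subgroup generated by [I]. *)
Definition in_parabolic I w := exists2 p, all (mem I) p & wprod p = w.

Lemma in_parabolic_reduced I w : in_parabolic I w ->
  exists p, [/\ all (mem I) p, wprod p = w & reduced p].
Proof.
move=> [p]; have [n] := ubnP (size p); elim: n p => // n IH p pn Ip pw.
have [rp|] := boolP (reduced p); first by exists p.
rewrite reducedE => /(refls_dup hW)[p1 [s [p2 [t [p3 [pE E]]]]]].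
apply: (IH (p1 ++ p2 ++ p3)); last by rewrite -E.
  by move: pn; rewrite pE !size_cat /= size_cat /=; lia.
by move: Ip; rewrite pE !all_cat /= !all_cat /= => /and5P[-> _ -> _ ->].
Qed.

Lemma in_parabolicM I u v :
  in_parabolic I u -> in_parabolic I v -> in_parabolic I (u * v).
Proof.
by move=> [p Ip <-] [q Iq <-]; exists (p ++ q); rewrite ?all_cat ?Ip ?wprod_cat.
Qed.

Lemma in_parabolicV I u : in_parabolic I u -> in_parabolic I (monoid.inv u).
Proof. by move=> [p Ip <-]; exists (rev p); rewrite ?all_rev ?(wprod_rev hW). Qed.

Lemma in_parabolic1 I : in_parabolic I 1.
Proof. by exists [::]; rewrite ?big_nil. Qed.

Lemma in_parabolic_gen I s : s \in I -> in_parabolic I (gen s).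
Proof. by move=> Is; exists [:: s]; rewrite /= ?Is ?big_seq1. Qed.

(** Exchange writes [gen s] as a product of letters of [I]; a reduced such word has length one, so
    its letter is [s]. *)
Lemma descent_in_parabolic I s w : in_parabolic I w -> descent s w -> s \in I.
Proof.
move=> [p Ip <-] /exchange[p1 [t [p2 [pE E]]]].
have : in_parabolic I (gen s).
  rewrite -(mulgK (wprod p) (gen s)) E; apply: in_parabolicM.
    exists (p1 ++ p2) => //; move: Ip; rewrite pE !all_cat /=.
    by move=> /and3P[-> _ ->].
  by apply: in_parabolicV; exists p.
move=> /in_parabolic_reduced[[|a [|b q]] [Ia aE ra]].
- by move: (len_gen s); rewrite -aE big_nil len1.
- by move: Ia; rewrite big_seq1 in aE; rewrite /= (gen_inj aE) andbT.
- by move: (reducedP _ ra); rewrite aE len_gen.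
Qed.

(** [y] is a shortest element of the coset W_I w. If adding a letter of [I] to a reduced [x']
    shortened [x' * y], the deleted letter would lie in [y], giving a shorter element of the
    coset. *)
Lemma coset_decomposition I w : exists x y, [/\ in_parabolic I x, w = x * y
  & forall x', in_parabolic I x' -> ladd x' y].
Proof.
pose P n := `[< exists x y, [/\ in_parabolic I x, w = x * y & len y = n] >].
have ex : exists n, P n.
  exists (len w); apply/asboolP; exists 1, w; split; rewrite ?mul1g //.
  exact: in_parabolic1.
case: (ex_minnP ex) => n /asboolP[x [y [Ix wE yn]]] min_n; exists x, y; split=> //.
move=> _ /in_parabolic_reduced[p [Ip <- rp]].
elim: p Ip rp => [|s p IH] /=; first by rewrite big_nil -dvd_ladd dvd1.
move=> /andP[Is Ip]; rewrite reduced_cons big_cons => /andP[rp nds].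
have py := IH Ip rp; have := ladd_gen s (wprod p); rewrite nds => sp.
rewrite laddA // py andbT ladd_gen; apply/negP.
have [q qy rq] := reduced_word y; rewrite -qy -wprod_cat => /descent_refls.
rewrite (refls_cat hW) mem_cat => /orP[sp'|/mapP[z /(refls_delete hW) zq sE]].
  by rewrite (refls_descent rp sp') in nds.
have [q1 [t [q2 [qE E]]]] := zq.
(* [z] is the conjugate of [gen s] by an element of W_I, so [z * y] is in the same coset, and it is
   shorter by the deletion. *)
suff /min_n : P (len (z * y)).
  rewrite -yn -qy (eqP rq) E qE; apply/negP; rewrite -ltnNge.
  by apply: leq_ltn_trans (len_wprod _) _; rewrite !size_cat /=; lia.
have zV : z * z = 1.
  have := congr1 (fun a => (wprod p)^-1 * (a * a) * wprod p) sE.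
  by rewrite (genK hW) mulg1 mulVg -!mulWA mulVg mulg1 !mulKg.
have Iz : in_parabolic I z.
  have -> : z = (wprod p)^-1 * gen s * wprod p.
    by rewrite sE !mulWA mulVg mul1g mulgVK.
  by do !apply: in_parabolicM; [apply: in_parabolicV|apply: in_parabolic_gen|];
     rewrite //; exists p.
apply/asboolP; exists (x * z), (z * y); split=> //; first exact: in_parabolicM.
by rewrite wE -!mulWA (mulWA z) zV mul1g.
Qed.

Lemma rev_alt s t n : rev (alt s t n) = if odd n then alt s t n else alt t s n.
Proof.
elim: n s t => // n IH s t.
rewrite -{1}addn1 altD rev_cat IH /=.
by case: (odd n).
Qed.

Lemma wprod_alt s t n : m s t = Some n -> wprod (alt s t n) = wprod (alt t s n).
Proof.
move=> mst; have := prod_alt_double gen s t n.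
rewrite (cox_relation hW mst) -addnn altD wprod_cat => /mulg1_eq.
rewrite -(wprod_rev hW) rev_alt; by case: (odd n).
Qed.

Lemma reduced_alt s t n : s != t -> (forall k, m s t = Some k -> n <= k) ->
  reduced (alt s t n).
Proof.
move=> st nk; rewrite reducedE refls_alt; apply/mkseq_uniqP => i j.
wlog ij : i j / i < j => [IH|] ii jj.
  have [lt|gt|//] := ltngtP i j; first exact: IH.
  by move=> /esym E; apply/esym/IH.
move=> /mulIg E; case: (@cox_order _ _ _ _ _ hW s t (j - i) st).
- by rewrite subn_gt0.
- by move=> k /nk kn; move: jj; rewrite inE; lia.
- by apply: (mulgI ((gen s * gen t) ^+ i)); rewrite -expgnDr mulg1 subnKC // ltnW.
Qed.

(** Beyond length [k], the braid relation applied behind the first letter puts two equal letters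
    side by side. *)
Lemma reduced_alt_leq s t n k : s != t -> m s t = Some k ->
  reduced (alt s t n) -> n <= k.
Proof.
move=> st mst; have [//|kn] := leqP n k; rewrite -(subnKC kn) altD.
move=> /reduced_cat[+ _]; rewrite /= reduced_cons => /andP[_].
have [j kE] := cox_ge2 hW st mst; rewrite -(wprod_alt mst) kE /= big_cons.
rewrite descent_gen negbK => ds; have : reduced (alt s t k).
  by apply: reduced_alt => // k'; rewrite mst => -[->].
by rewrite kE /= reduced_cons ds andbF.
Qed.

Lemma reduced_pair s t p : all (mem [set s; t]) p -> reduced p ->
  p = alt s t (size p) \/ p = alt t s (size p).
Proof.
elim: p => [|a p IH]; first by left.
rewrite /= reduced_cons => /andP[ast pst] /andP[rp nd].
have E : p = alt s t (size p) \/ p = alt t s (size p) by exact: IH.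
have hd b q : p = b :: q -> a != b.
  by move=> pE; apply: contraNneq nd => ->; rewrite pE big_cons descent_gen;
     move: rp; rewrite pE reduced_cons => /andP[].
case: p hd E {IH pst rp nd} => [|b p] hd E.
  by move: ast; rewrite !inE => /orP[]/eqP->; [left|right].
have := hd _ _ erefl; move: ast; rewrite !inE.
case: E => /= -[-> pE] /orP[]/eqP->; rewrite ?eqxx // => _.
  by right; rewrite -pE.
by left; rewrite -pE.
Qed.

(** The W_{s,t}-part [x] of [w] still has both descents. A reduced word of [x] alternates and can be
    extended on the left by neither letter, so [m s t] is finite and [x] is the longest element. *)
Lemma rank2 s t w : s != t -> descent s w -> descent t w ->
  exists n, [/\ m s t = Some n, divides gen (wprod (alt s t n)) w
    & forall x, in_parabolic [set s; t] x -> divides gen x (wprod (alt s t n))].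
Proof.
move=> st ds dt; have [x [y [Ix wE xy]]] := coset_decomposition [set s; t] w.
have dx a : a \in [set s; t] -> descent a w -> descent a x.
  move=> ast; have h1 := xy _ Ix.
  have h2 := xy _ (in_parabolicM (in_parabolic_gen ast) Ix).
  by rewrite /descent wE mulWA (eqP h1) (eqP h2) ltn_add2r.
have [p [Ip px rp]] := in_parabolic_reduced Ix.
have alt_dvd a b n : a != b -> m a b = Some n ->
    forall z, in_parabolic [set a; b] z -> divides gen z (wprod (alt a b n)).
  move=> ab mab z /in_parabolic_reduced[q [Iq <- rq]].
  have [k kn qE] : exists2 k, k <= n & q = alt a b k \/ q = alt b a k.
    have [qE|qE] := reduced_pair Iq rq; exists (size q); rewrite -?qE; auto.
      by apply: (reduced_alt_leq ab mab); rewrite -qE.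
    by apply: (@reduced_alt_leq b a); rewrite 1?eq_sym // ?(cox_sym hW b) // -qE.
  have pre a' b' : a' != b' -> m a' b' = Some n ->
      divides gen (wprod (alt a' b' k)) (wprod (alt a' b' n)).
    move=> ab' mab'; have : reduced (alt a' b' n).
      by apply: reduced_alt => // j; rewrite mab' => -[->].
    rewrite -(subnKC kn) altD => rc; have [r1 r2] := reduced_cat rc.
    by rewrite wprod_cat dvd_ladd -reduced_cat_ladd.
  case: qE => ->; first exact: pre.
  by rewrite (wprod_alt mab); apply: pre; rewrite 1?eq_sym // (cox_sym hW).
have key a b : [set a; b] = [set s; t] -> a != b -> p = alt a b (size p) ->
    exists2 n, m a b = Some n & wprod (alt a b n) = x.
  move=> abE ab pE; have /dx : b \in [set s; t] by rewrite -abE set22.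
  have db : descent b w.
    have : b \in [set s; t] by rewrite -abE set22.
    by rewrite !inE => /orP[]/eqP->.
  move=> /(_ db) dbx; have nr : ~~ reduced (alt b a (size p).+1).
    by rewrite /= -pE reduced_cons px dbx andbF.
  case mab: (m a b) => [n|]; last first.
    case/negP: nr; apply: reduced_alt; first by rewrite eq_sym.
    by move=> k; rewrite (cox_sym hW) mab.
  exists n => //; rewrite -px pE; congr (wprod (alt a b _)); apply/eqP.
  rewrite eqn_leq (reduced_alt_leq ab mab) ?size_alt -?pE // andbT.
  rewrite leqNgt; apply: contra nr => np.
  apply: reduced_alt => [|k]; first by rewrite eq_sym.
  by rewrite (cox_sym hW) mab => -[<-].
have [n mn xE] : exists2 n, m s t = Some n & wprod (alt s t n) = x.
  have [/key[]//|/key] := reduced_pair Ip rp; first by move=> n; exists n.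
  rewrite finset.setUC eq_sym => /(_ erefl st)[n mn xE]; exists n.
    by rewrite (cox_sym hW).
  by rewrite wprod_alt // (cox_sym hW).
exists n; split=> //; last exact: alt_dvd.
by rewrite xE wE dvd_ladd xy.
Qed.

(** Write v = Y D, with D the W_{r,s}-part for the last two letters of a reduced word of [v]. By
    induction Y r and Y s divide [w], so by [rank2] so does the product of Y with the longest
    element of W_{r,s}, which is a multiple of [v]. *)
Lemma descents_parabolic I w v : (forall s, s \in I -> descent s w) ->
  in_parabolic I v -> divides gen v w.
Proof.
move=> dw; have [n] := ubnP (len v); elim: n v => // n IH v vn Iv.
have [p [Ip pv rp]] := in_parabolic_reduced Iv.
case/lastP: p => [|p s] in Ip pv rp *.
  by rewrite -pv big_nil dvd1.
case/lastP: p => [|p r] in Ip pv rp *.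
  by move: Ip pv; rewrite /= andbT big_seq1 => Is <-; rewrite dvd_gen dw.
move: Ip; rewrite !all_rcons /= => /and3P[Is Ir Ip].
(* The decomposition splits off left factors; inverting gives the right one. *)
have [x [y [Ix vE xy]]] := coset_decomposition [set r; s] v^-1.
pose Y : W := y^-1; pose D : W := x^-1.
have vYD : v = Y * D by rewrite -(invgK v) vE invWM.
have IrsD : in_parabolic [set r; s] D by exact: in_parabolicV.
have YD z : in_parabolic [set r; s] z -> ladd Y z.
  by move=> /in_parabolicV/xy; rewrite -laddV invgK.
have rsI z : in_parabolic [set r; s] z -> in_parabolic I z.
  move=> [q Iq <-]; exists q => //; apply: sub_all Iq => a.
  by rewrite !inE => /orP[]/eqP->.
have IY : in_parabolic I Y.
  rewrite -(mulgK D Y) -vYD; apply: in_parabolicM => //.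
  exact/in_parabolicV/rsI.
have lv : len v = (size p).+2 by rewrite -pv (eqP rp) !size_rcons.
(* Removing the last two letters from [v] keeps the factor [Y], additively; hence [Y] followed by
   one letter is still shorter than [v]. *)
have lY : len Y <= size p.
  have Isr : in_parabolic [set r; s] (D * gen s * gen r).
    by do 2?apply: in_parabolicM => //; apply: in_parabolic_gen; rewrite !inE eqxx ?orbT.
  have := YD _ Isr; rewrite /ladd !mulWA -vYD -pv -!cats1 !wprod_cat !big_seq1.
  rewrite !(Mgen hW); have := len_wprod p; lia.
have rs : r != s.
  apply: contraTneq rp => rs; rewrite rs -!cats1 -catA; apply/negP => /reduced_cat[_].
  by rewrite /= reduced_cons big_seq1 -[X in descent _ X]mulg1 descent_gen /descent mulg1 len1 len_gen andbF.
have dY a : a \in [set r; s] -> divides gen (Y * gen a) w /\ ladd Y (gen a).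
  move=> ars; have La : ladd Y (gen a) by apply: YD; apply: in_parabolic_gen.
  split=> //; apply: IH; first by rewrite (eqP La) len_gen; move: vn lv lY; lia.
  by apply: in_parabolicM => //; apply/rsI/in_parabolic_gen.
have [|Yr Lr] := dY r; first by rewrite !inE eqxx.
have [|Ys Ls] := dY s; first by rewrite !inE eqxx orbT.
have Yw : divides gen Y w by apply: dvd_trans Yr; rewrite dvd_ladd.
have [a wE Ya] := dvdP _ _ Yw; move: Yr Ys; rewrite wE !dvd_mulI // !dvd_gen.
move=> ra sa; have [k [_ na]] := rank2 rs ra sa => /(_ _ IrsD) Dn.
rewrite vYD; apply: (proj2 (dvd_mull Ya _)).
exact: dvd_trans na.
Qed.

Lemma parabolicE I : parabolic gen I = in_parabolic I.
Proof.
apply/funext => u; apply/propext; split.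
  move=> /(_ (in_parabolic I)); apply; split.
    by split; [exact: in_parabolic1|exact: in_parabolicM|exact: in_parabolicV].
  by move=> _ [s /= sI <-]; apply: in_parabolic_gen.
move=> [p Ip <-] H [[H1 HM _] Hg].
elim: p Ip => [_|s p IH /= /andP[Is Ip]]; first by rewrite big_nil.
by rewrite big_cons; apply: HM; [apply: Hg; exists s|exact: IH].
Qed.

(** All elements of W_I divide [w], so their lengths are bounded and [w0] does not take its default
    value. *)
Lemma w0_max I w : (forall s, s \in I -> descent s w) ->
  in_parabolic I (w0 gen I) /\
  forall u, in_parabolic I u -> len u <= len (w0 gen I).
Proof.
move=> dw; suff [x Px] : exists x, parabolic gen I x /\
    forall u, parabolic gen I u -> len u <= len x.
  have : parabolic gen I (w0 gen I) /\
    forall u, parabolic gen I u -> len u <= len (w0 gen I).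
    exact: (xgetPex 1 (ex_intro [set w | parabolic gen I w /\
      forall u, parabolic gen I u -> len u <= len w]%classic x Px)).
  by rewrite parabolicE.
rewrite parabolicE; pose P n := `[< exists2 x, in_parabolic I x & len x = n >].
have ex : exists n, P n.
  by exists 0; apply/asboolP; exists 1; [exact: in_parabolic1|exact: len1].
have bd n : P n -> n <= len w.
  by move=> /asboolP[x Ix <-]; apply/dvd_leq/(@descents_parabolic I).
case: (ex_maxnP ex bd) => n /asboolP[x Ix xn] mx; exists x; split=> // u Iu.
by rewrite xn; apply: mx; apply/asboolP; exists u.
Qed.

Lemma w0_descent I w s : (forall s, s \in I -> descent s w) ->
  s \in I -> descent s (w0 gen I).
Proof.
move=> /w0_max[Iw mx] Is; apply: contraT => /descentN E.
by have := mx _ (in_parabolicM (in_parabolic_gen Is) Iw); rewrite E ltnn.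
Qed.

Lemma w0_dvd I w : (forall s, s \in I -> descent s w) -> divides gen (w0 gen I) w.
Proof. by move=> dw; apply: (descents_parabolic dw); case: (w0_max dw). Qed.

Lemma dvd_w0 I w u : (forall s, s \in I -> descent s w) ->
  in_parabolic I u -> divides gen u (w0 gen I).
Proof. by move=> dw; apply: descents_parabolic => s; apply: w0_descent dw. Qed.

Lemma w0_unique I x : in_parabolic I x -> (forall s, s \in I -> descent s x) ->
  w0 gen I = x.
Proof.
move=> Ix dx; apply/esym/dvd_eq; first exact: w0_dvd.
by apply/dvd_leq/(dvd_w0 dx).
Qed.

(** This yields the finiteness condition of [Zcell] from the existence of a common multiple. *)
Lemma finite_parabolic I w : (forall s, s \in I -> descent s w) ->
  finite_set (parabolic gen I).
Proof.
move=> dw; rewrite parabolicE.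
pose f (x : {n : 'I_(len w).+1 & n.-tuple S}) := wprod (tagged x).
apply: sub_finite_set (finite_image f (@finite_finset _ [set: _]%classic)) => u Iu.
have [p pu sp] := len_word u.
have up : size p < (len w).+1.
  by rewrite ltnS sp; apply/dvd_leq/(descents_parabolic dw).
by exists (Tagged (fun n : 'I__ => n.-tuple S) (in_tuple p : (Ordinal up).-tuple S)).
Qed.

Lemma in_parabolic_alt s t n : in_parabolic [set s; t] (wprod (alt s t n)).
Proof.
exists (alt s t n) => //; elim: n s t => //= n IH s t.
by rewrite finset.setUC IH !inE eqxx orbT.
Qed.

Lemma w0_pair s t n : s != t -> m s t = Some n ->
  w0 gen [set s; t] = wprod (alt s t n).
Proof.
move=> st mst; have [k nk] := cox_ge2 hW st mst.
have ra : reduced (alt s t n) by apply: reduced_alt => // j; rewrite mst => -[->].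
have rb : reduced (alt t s n).
  by apply: reduced_alt; rewrite 1?eq_sym // => j; rewrite (cox_sym hW) mst => -[->].
have hd a p : reduced (a :: p) -> descent a (wprod (a :: p)).
  by rewrite reduced_cons big_cons descent_gen => /andP[].
apply: w0_unique.
  exact: in_parabolic_alt.
move=> a; rewrite !inE => /orP[]/eqP->.
  by move: ra; rewrite nk; apply: hd.
by rewrite wprod_alt //; move: rb; rewrite nk; apply: hd.
Qed.

End Length.

(** * Divisibility in the Artin monoid *)

Section ArtinWords.
Context {d : Order.disp_t} {S : finOrderType d}.
Context {m : S -> S -> option nat} {W : groupType} {gen : S -> W}.
Hypothesis hW : coxeter_group m gen.
Implicit Types (s t r : S) (n k : nat) (u v w x y : W) (p q z : seq S) (I : {set S}).

Local Notation wprod p := (\prod_(s <- p) gen s).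
Local Notation len := (len gen).
Local Notation "p ~ q" := (mcongruent (artin_relation m) p q) (at level 70).
Local Notation reduced := (@reduced _ S W gen).
Local Notation descent := (@descent _ S W gen).
Local Notation in_parabolic := (@in_parabolic _ S W gen).
Local Notation ladd := (@ladd _ S W gen).

Lemma mc_size p q : p ~ q -> size p = size q.
Proof.
elim=> // [_ _ [s t n _ _]|a b c _ -> _ ->|a a' b b' _ E _ F] //.
  by rewrite !size_alt.
by rewrite !size_cat E F.
Qed.

Lemma mc_wprod p q : p ~ q -> wprod p = wprod q.
Proof.
elim=> // [_ _ [s t n _ mst]|a b c _ -> _ ->|a a' b b' _ E _ F] //.
  exact: (wprod_alt hW).
by rewrite !wprod_cat E F.
Qed.

Lemma mc_catl p q z : p ~ q -> z ++ p ~ z ++ q.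
Proof. by move=> pq; apply: mc_cat pq; apply: mc_refl. Qed.

Lemma mc_catr p q z : p ~ q -> p ++ z ~ q ++ z.
Proof. by move=> pq; apply: mc_cat pq _; apply: mc_refl. Qed.

Lemma mc_cons s p q : p ~ q -> s :: p ~ s :: q.
Proof. exact: (@mc_catl _ _ [:: s]). Qed.

Lemma mc_alt s t n z : s != t -> m s t = Some n ->
  alt s t n ++ z ~ alt t s n ++ z.
Proof. by move=> st mst; apply/mc_catr/mc_gen. Qed.

Lemma reduced_altm s t n : s != t -> m s t = Some n -> reduced (alt s t n).
Proof. by move=> st mst; apply: (reduced_alt hW st) => k; rewrite mst => -[->]. Qed.

Lemma mc_invariant (P : seq S -> Prop) :
    (forall a b s t n, s != t -> m s t = Some n ->
       P (a ++ alt s t n ++ b) -> P (a ++ alt t s n ++ b)) ->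
  forall p q, p ~ q -> P p -> P q.
Proof.
move=> Pst p q pq.
suff H a b : P (a ++ p ++ b) <-> P (a ++ q ++ b).
  by have := H [::] [::]; rewrite /= !cats0 => -[].
elim: pq a b => {p q} [_ _ [s t n st mst] a b|//|p q _ IH a b|p q r _ IH1 _ IH2 a b|].
- split; first exact: Pst.
  by apply: Pst; rewrite 1?eq_sym // (cox_sym hW).
- by split => /IH.
- by split => [/IH1/IH2|/IH2/IH1].
move=> p p' q q' _ IHp _ IHq a b; rewrite -!catA.
have := IHq (a ++ p') b; rewrite -!catA => H.
exact: iff_trans (IHp a (q ++ b)) H.
Qed.

(** If the first letters [s] and [t] differ, their lcm divides the element; both words are joined,
    by induction behind their first letters, to the two alternating words of the lcm followed by a
    common tail. *)
Lemma matsumoto p q : reduced p -> reduced q -> wprod p = wprod q -> p ~ q.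
Proof.
have [n] := ubnP (size p); elim: n p q => // n IH p q pn rp rq pq.
have spq : size p = size q by rewrite -(eqP rp) -(eqP rq) pq.
case: p q => [|s p] [|t q] // in pn rp rq pq spq *; first exact: mc_refl.
have [rp' rq'] : reduced p /\ reduced q.
  by move: rp rq; rewrite !(reduced_cons hW) => /andP[-> _] /andP[-> _].
have [st|st] := eqVneq s t.
  move: pq; rewrite st !big_cons => /mulgI pq; apply: mc_cons; exact: IH.
have hd a b : reduced (a :: b) -> descent a (wprod (a :: b)).
  by rewrite (reduced_cons hW) big_cons (descent_gen hW) => /andP[].
have dt : descent t (wprod (s :: p)) by rewrite pq; apply: hd.
have [j [mst /dvdP[y wE ay] _]] := rank2 hW st (hd _ _ rp) dt.
have [b yE rb] := reduced_word hW y.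
have [i jE] := cox_ge2 hW st mst; subst j y.
have ra : reduced (alt s t i.+2 ++ b).
  by rewrite reduced_cat_ladd // reduced_altm.
have rc : reduced (alt t s i.+2 ++ b).
  rewrite reduced_cat_ladd //; first by rewrite -(wprod_alt hW).
  by apply: reduced_altm; rewrite 1?eq_sym // (cox_sym hW).
have wE' : wprod (t :: q) = wprod (alt t s i.+2) * wprod b.
  by rewrite -pq wE (wprod_alt hW).
have [_ ra'] := reduced_cat hW (ra : reduced ([:: s] ++ (alt t s i.+1 ++ b))).
have [_ rc'] := reduced_cat hW (rc : reduced ([:: t] ++ (alt s t i.+1 ++ b))).
have cns a z : gen a * wprod z = wprod (a :: z) by rewrite big_cons.
have pE : p ~ alt t s i.+1 ++ b.
  apply: IH; rewrite ?wprod_cat //; apply: (mulgI (gen s)).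
  by rewrite mulWA !cns.
have qE : q ~ alt s t i.+1 ++ b.
  apply: IH; rewrite ?wprod_cat //; first by move: spq pn => /= [<-].
  by apply: (mulgI (gen t)); rewrite mulWA !cns.
apply: mc_trans (mc_cons s pE) _; apply: mc_trans (mc_sym (mc_cons t qE)).
exact: (mc_alt b st mst).
Qed.

(** A nontrivial W_I-part of the inverse of [y] would begin with a letter of [I], against additivity
    with that letter; so this inverse is the shortest element of its coset. *)
Lemma ladd_parabolic I y x : (forall s, s \in I -> ladd y (gen s)) ->
  in_parabolic I x -> ladd y x.
Proof.
move=> yI Ix; have [u [v [Iu yE uv]]] := coset_decomposition hW I (monoid.inv y).
have u1 : u = 1.
  have [[|s p] [Ip pu rp]] := in_parabolic_reduced hW Iu.
    by rewrite -pu big_nil.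
  move: Ip => /= /andP[Is _]; have := yI s Is.
  rewrite -(laddV hW) (genV hW) (ladd_gen hW) yE => /negP[].
  have dsp : descent s (wprod (s :: p)).
    by move: rp; rewrite (reduced_cons hW) big_cons (descent_gen hW) => /andP[].
  by apply: (descent_dvd hW dsp); rewrite pu dvd_ladd uv.
move: yE; rewrite u1 mul1g => yE; rewrite -(laddV hW) yE; apply: uv.
exact: (in_parabolicV hW).
Qed.

(** A longest candidate is the greatest. If y s divides the candidate [x] and y t divides [g], then
    [y] times the lcm of s and t is again a candidate. It shares y t with [g], so by induction it
    divides [g], and thus y s divides both [x] and [g]. *)
Lemma maximal_prefix u v : exists g, [/\ divides gen g v, ladd u g
  & forall x, divides gen x v -> ladd u x -> divides gen x g].
Proof.
pose E x := divides gen x v /\ ladd u x.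
pose P n := `[< exists2 x, E x & len x = n >].
have ex : exists n, P n.
  exists 0; apply/asboolP; exists 1; last exact: len1.
  split; first exact: dvd1.
  by apply/laddP; rewrite mulg1 len1 addn0.
have bd n : P n -> n <= len v by move=> /asboolP[x [xv _] <-]; apply: dvd_leq.
case: (ex_maxnP ex bd) => n /asboolP[g [gv ug] gn] mx; exists g; split=> //.
(* [y] is a common divisor of [x] and [g]; the induction lets it grow towards [g]. *)
suff H y : divides gen y g -> forall x, E x -> divides gen y x -> divides gen x g.
  by move=> x xv ux; apply: (H 1) => //; apply: dvd1.
have [k] := ubnP (len g - len y); elim: k y => // k IH y yk yg x [xv ux] yx.
have [->//|neqyx] := eqVneq x y.
have [|s [ys sx]] := dvd_step hW yx; first by rewrite eq_sym.
have [gy|ne] := eqVneq y g.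
  have : len x <= n by apply: mx; apply/asboolP; exists x.
  rewrite -gn -gy => xy; have {}xy := dvd_eq hW yx xy; by rewrite xy eqxx in neqyx.
have [t [yt tg]] := dvd_step hW yg ne.
have lt a : ladd y (gen a) -> divides gen (y * gen a) g ->
    len g - len (y * gen a) < k.
  move=> /eqP ya /dvd_leq; move: yk; rewrite ya (len_gen hW); lia.
have [st|st] := eqVneq s t.
  by apply: (IH _ (lt _ yt tg) tg) => //; rewrite -st.
have [c vE yc] := dvdP _ _ (dvd_trans hW yx xv).
have sv := dvd_trans hW sx xv; have tv := dvd_trans hW tg gv.
rewrite vE !(dvd_mulI) // !(dvd_gen hW) in sv tv.
have [j [mst jc Ij]] := rank2 hW st sv tv.
set D := wprod (alt s t j) in jc Ij.
have [yD Dv] := dvd_mull hW yc jc; rewrite -vE in Dv.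
have uy : ladd u y by case: (dvd_mull hW ug yg).
have ED : E (y * D).
  split=> //; rewrite (laddr hW _ yD) uy andbT.
  apply: (ladd_parabolic _ (in_parabolic_alt s t j)) => a; rewrite !inE.
  have ua b : ladd y (gen b) -> ladd u (y * gen b) -> ladd (u * y) (gen b).
    by move=> yb; rewrite (laddr hW _ yb) => /andP[].
  move=> /orP[]/eqP->; apply: ua => //; first by case: (dvd_mull hW ux sx).
  by case: (dvd_mull hW ug tg).
have Dg : divides gen (y * D) g.
  apply: (IH _ (lt _ yt tg) tg) => //.
  by rewrite dvd_mulI // Ij //; apply: in_parabolic_gen; rewrite !inE eqxx orbT.
have sg : divides gen (y * gen s) g.
  apply: (dvd_trans hW _ Dg).
  by rewrite dvd_mulI // Ij //; apply: in_parabolic_gen; rewrite !inE eqxx.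
exact: (IH _ (lt _ ys sg) sg).
Qed.

Lemma dvd_anti u v : divides gen u v -> divides gen v u -> u = v.
Proof. by move=> uv vu; apply: (dvd_eq hW vu); apply: dvd_leq. Qed.

(* The greatest prefix that lifts an element of [W] of the product of the lifts
   of [u] and [v] to the Artin monoid. *)
Definition rhd u v : W := u * projT1 (cid (maximal_prefix u v)).

Lemma rhdP u v : exists g, [/\ rhd u v = u * g, divides gen g v, ladd u g
  & forall x, divides gen x v -> ladd u x -> divides gen x g].
Proof.
by rewrite /rhd; case: cid => g [gv ug mg] /=; exists g.
Qed.

Lemma rhd1 v : rhd 1 v = v.
Proof.
have [g [-> gv _ mg]] := rhdP 1 v; rewrite mul1g.
apply: dvd_anti => //; apply: mg; first exact: dvd_refl.
by rewrite -dvd_ladd dvd1.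
Qed.

(** This makes [act] invariant under braid relations, whose two sides are reduced words of one
    element. *)
Lemma rhdM u u' v : ladd u u' -> rhd (u * u') v = rhd u (rhd u' v).
Proof.
move=> uu'; have [g3 [-> g3v L3 m3]] := rhdP (u * u') v.
have [v1 [-> v1v L1 m1]] := rhdP u' v.
have [g2 [-> g2v L2 m2]] := rhdP u (u' * v1).
rewrite -mulWA; congr (u * _).
move: (L3); rewrite (laddA hW _ uu') => /andP[L3u L3u'].
apply: dvd_anti.
  by apply: m2 => //; apply: (proj2 (dvd_mull hW L1 _)); apply: m1.
have /dvdP[y g2E u'y] : divides gen u' g2 by apply: m2; rewrite ?dvd_ladd.
move: g2v L2; rewrite g2E dvd_mulI // (laddr hW _ u'y) => yv1 /andP[uu'y _].
by apply: (proj2 (dvd_mull hW L3u' _)); apply: m3 => //; apply: (dvd_trans hW yv1).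
Qed.

Definition act p v := foldr (fun s => rhd (gen s)) v p.

Lemma act_cat p q v : act (p ++ q) v = act p (act q v).
Proof. exact: foldr_cat. Qed.

Lemma act_reduced p v : reduced p -> act p v = rhd (wprod p) v.
Proof.
elim: p => [|s p IH] rp /=; first by rewrite big_nil rhd1.
move: rp; rewrite (reduced_cons hW) -(ladd_gen hW) => /andP[rp sp].
by rewrite IH // big_cons rhdM.
Qed.

Lemma act_mc p q v : p ~ q -> act p v = act q v.
Proof.
move=> pq; elim: pq v => {p q} // [_ _ [s t n st mst] v|p q r _ IH1 _ IH2 v|].
- have rts : reduced (alt t s n).
    by apply: reduced_altm; rewrite 1?eq_sym // (cox_sym hW).
  by rewrite !act_reduced ?(wprod_alt hW mst) //; apply: reduced_altm.
- by rewrite IH1 IH2.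
- by move=> p p' q q' _ IH1 _ IH2 v; rewrite !act_cat IH1 IH2.
Qed.

(* The greatest reduced left divisor of the class of [p] in the Artin monoid. *)
Definition head p := act p 1.

Lemma dvd_head q p : reduced q -> divides gen (wprod q) (head (q ++ p)).
Proof.
move=> rq; rewrite /head act_cat act_reduced //.
by have [g [-> _ L _]] := rhdP (wprod q) (act p 1); rewrite dvd_ladd.
Qed.

Lemma head_mc p q : p ~ q -> head p = head q.
Proof. exact: act_mc. Qed.

Lemma descent_head s p : descent s (head (s :: p)).
Proof.
have rs : reduced [:: s] by rewrite (reducedE hW).
by have := dvd_head p rs; rewrite big_seq1 (dvd_gen hW).
Qed.

(** Every word is congruent to a reduced word of its head followed by a tail: when a letter is
    prefixed, the part of the old head that cannot stay is moved to the tail. Matsumoto then brings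
    [q] to the front. *)
Lemma factor_head q p : reduced q -> divides gen (wprod q) (head p) ->
  exists z, p ~ q ++ z.
Proof.
move=> rq qp; suff [r [z [rr rE pz]]] : exists r z : seq S,
    [/\ reduced r, wprod r = head p & p ~ r ++ z].
  move: qp; rewrite -rE => /dvdP[x wE qx]; have [y yE ry] := reduced_word hW x.
  exists (y ++ z); apply: mc_trans pz _; rewrite catA; apply/mc_catr/matsumoto => //.
    by rewrite reduced_cat_ladd // yE.
  by rewrite wprod_cat yE.
elim: p {q rq qp} => [|s p [r [z [rr rE pz]]]].
  exists [::], [::]; rewrite /head /= big_nil; split=> //; last exact: mc_refl.
  by rewrite (reducedE hW).
rewrite /head /=; have [g [-> gp sg _]] := rhdP (gen s) (act p 1).
have [y yE ry] := reduced_word hW g; have /dvdP[x wE gx] := gp.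
have [b bE rb] := reduced_word hW x.
exists (s :: y), (b ++ z); split; last 1 first.
- rewrite cat_cons; apply: mc_cons; apply: mc_trans pz _; rewrite catA.
  apply/mc_catr/matsumoto => //; first by rewrite reduced_cat_ladd // yE bE.
  by rewrite wprod_cat yE bE rE.
- by rewrite (reduced_cons hW) ry -(ladd_gen hW) yE.
- by rewrite big_cons yE.
Qed.

(** A weak form of cancellation, obtained from heads alone and used to prove [mc_cancel]; [z'] need
    not be related to [z]. *)
Lemma mc_quotient q1 q2 p z : reduced (q1 ++ q2) -> q1 ++ p ~ (q1 ++ q2) ++ z ->
  exists z', p ~ q2 ++ z'.
Proof.
move=> r12 /head_mc E; have := dvd_head z r12; rewrite -E /head act_cat.
have [r1 r2] := reduced_cat hW r12; rewrite act_reduced //.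
have [g [-> gp L _]] := rhdP (wprod q1) (act p 1).
rewrite wprod_cat dvd_mulI //; last by rewrite -reduced_cat_ladd.
by move=> qg; apply: factor_head => //; apply: (dvd_trans hW qg).
Qed.

Lemma factor_w0 I p q : (forall s, s \in I -> descent s (head p)) ->
  reduced q -> wprod q = w0 gen I -> exists z, p ~ q ++ z.
Proof. by move=> dI rq qE; apply: factor_head => //; rewrite qE (w0_dvd hW). Qed.

Lemma extend_w0 I p q : (forall s, s \in I -> descent s (head p)) ->
  reduced q -> all (mem I) q -> exists q', reduced (q ++ q') /\ wprod (q ++ q') = w0 gen I.
Proof.
move=> dI rq Iq; have : divides gen (wprod q) (w0 gen I).
  by apply: (dvd_w0 hW dI); exists q.
move=> /dvdP[x wE qx]; have [y yE ry] := reduced_word hW x.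
by exists y; rewrite reduced_cat_ladd // wprod_cat yE.
Qed.

Lemma reduced_mc p q : p ~ q -> reduced p -> reduced q.
Proof.
move=> pq /reducedP rp; apply/reducedP.
by rewrite -(mc_wprod pq) rp (mc_size pq).
Qed.

Lemma matsumoto_cons s p q : reduced (s :: p) -> reduced (s :: q) ->
  wprod (s :: p) = wprod (s :: q) -> p ~ q.
Proof.
rewrite !(reduced_cons hW) !big_cons => /andP[rp _] /andP[rq _] /mulgI.
exact: matsumoto.
Qed.

Lemma extend_alt I p s t k : (forall s, s \in I -> descent s (head p)) ->
    s != t -> m s t = Some k -> s \in I -> t \in I ->
  exists q, [/\ reduced (alt s t k ++ q), wprod (alt s t k ++ q) = w0 gen I,
    reduced (alt t s k ++ q) & wprod (alt t s k ++ q) = w0 gen I].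
Proof.
move=> dI st mst Is It; have [|q [rq qE]] := extend_w0 dI (reduced_altm st mst).
  by elim: (k) (s) (t) Is It => //= j IH a b Ia Ib; rewrite Ia IH.
have E := mc_alt q st mst; exists q; split=> //; first exact: reduced_mc rq.
by rewrite -(mc_wprod E).
Qed.

Lemma descent_head_alt p s t k z : s != t -> m s t = Some k.+1 ->
  p ~ alt s t k.+1 ++ z -> descent s (head p) /\ descent t (head p).
Proof.
move=> st mst pE; split; first by rewrite (head_mc pE); apply: descent_head.
by rewrite (head_mc (mc_trans pE (mc_alt z st mst))); apply: descent_head.
Qed.

(* [D P] says that [P] is congruent to [s :: p] by one of the ways in which
   two letters divide a word: equality of the first letters, or division by
   their lcm. It is invariant under braid moves, the case of a move between
   two letters [u] and [t] other than [s] being solved inside the parabolic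
   subgroup of [s], [u] and [t]. *)
Lemma mc_cancel s p q : s :: p ~ s :: q -> p ~ q.
Proof.
have [n] := ubnP (size p); elim: n s p q => // n IH s p q pn spq.
have cancel a b c : size (a ++ b) <= size p -> a ++ b ~ a ++ c -> b ~ c.
  elim: a => //= x a IHa ab abc; apply: IHa; first exact: ltnW.
  exact: IH (leq_trans ab pn) abc.
pose D (P : seq S) := exists r P', P = r :: P' /\ (r = s /\ p ~ P' \/ r <> s /\
  exists k (y : seq S), [/\ m s r = Some k.+1, P' ~ alt s r k ++ y & p ~ alt r s k ++ y]).
(* The length is carried along so that the induction hypothesis, through [cancel], applies to tails
   of the rewritten word. *)
suff : size (s :: q) = (size p).+1 /\ D (s :: q).
  by move=> [_ [r [P' [[<- <-] [[]|[[]]]]]]].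
apply: (@mc_invariant (fun P => size P = (size p).+1 /\ D P) _ _ _ spq).
  move=> [|r a] b u t j ut mut [sz DP].
    have [i jE] := cox_ge2 hW ut mut; subst j.
    split; first by move: sz; rewrite !size_cat !size_alt.
    have {DP} [_ [_ [[<- <-]]]] := DP; rewrite -/cat -/alt => DP.
    exists t, (alt u t i.+1 ++ b); split=> //.
    have {sz} szt : size (alt t u i.+1 ++ b) = size p by case: sz.
    case: DP => [[us pE]|[us [k [y [msu bE pE]]]]].
      right; rewrite -us; split; first by move=> tu; rewrite tu eqxx in ut.
      by exists i.+1, b; split=> //; apply: mc_refl.
    have us' : s != u by apply/eqP => su; apply: us.
    (* The move brings [s] back to the front: both lcms are those of [s] and [u], and it remains to
       compare the tails. *)
    have [ts|/eqP ts] := eqVneq t s.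
      left; split=> //; subst t; rewrite (cox_sym hW) mut in msu.
      case: msu => kE; subst k; apply: mc_trans pE _; apply: mc_catl.
      by apply: (cancel _ _ _ _ (mc_sym bE)); rewrite -(mc_size bE) szt.
    right; split=> //; have st : s != t by apply/eqP => st; apply: ts.
    (* Three distinct letters divide [P], hence so does the longest element of W_I. Each of the
       three pairwise lcms is completed to it, by [q2], [q3] and [q4]. *)
    pose P := alt u t i.+2 ++ b; pose I := [set s; u; t]%SET.
    have PE : P ~ alt s u k.+1 ++ y.
      apply: mc_trans (mc_alt y _ _); [|by rewrite eq_sym|by rewrite (cox_sym hW)].
      exact: (mc_cons u bE).
    have [ds du] := descent_head_alt us' msu PE.
    have [_ dt] := descent_head_alt ut mut (mc_refl _ P).
    have dI a : a \in I -> descent a (head P) by rewrite !inE => /orP[/orP[]|]/eqP->.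
    have [Is Iu It] : [/\ s \in I, u \in I & t \in I] by rewrite !inE !eqxx !orbT.
    have [[|k'] [mst _ _]] := rank2 hW st ds dt.
      by have [? ] := cox_ge2 hW st mst.
    have [q2 [ut_r ut_w tu_r tu_w]] := extend_alt dI ut mut Iu It.
    have [q3 [su_r su_w us_r us_w]] := extend_alt dI us' msu Is Iu.
    have [q4 [st_r st_w ts_r ts_w]] := extend_alt dI st mst Is It.
    have [z0 Pz0] := factor_w0 dI ut_r ut_w.
    have [y' bE'] := mc_quotient ut_r Pz0.
    (* Between reduced words of the longest element, the common first letter may be cancelled, since
       cancellation takes place in [W]. *)
    have Eu : alt t u i.+1 ++ q2 ~ alt s u k ++ q3.
      by apply: (@matsumoto_cons u) => //; rewrite ut_w -us_w.
    have Et : alt u t i.+1 ++ q2 ~ alt s t k' ++ q4.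
      by apply: (@matsumoto_cons t) => //; rewrite tu_w -ts_w.
    have Es : alt u s k ++ q3 ~ alt t s k' ++ q4.
      by apply: (@matsumoto_cons s) => //; rewrite su_w -st_w.
    have yE : y ~ q3 ++ y'.
      apply: (cancel (alt s u k)); first by rewrite -(mc_size bE) szt.
      apply: mc_trans (mc_sym bE) _; apply: mc_trans (mc_catl (alt t u i.+1) bE') _.
      by rewrite !catA; apply: mc_catr.
    exists k', (q4 ++ y'); split=> //.
      by apply: mc_trans (mc_catl (alt u t i.+1) bE') _; rewrite !catA; apply: mc_catr.
    apply: mc_trans pE _; apply: mc_trans (mc_catl _ yE) _.
    by rewrite !catA; apply: mc_catr.
  have E : a ++ alt u t j ++ b ~ a ++ alt t u j ++ b by apply/mc_catl/mc_alt.
  split; first by rewrite -sz /= (mc_size E).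
  have {DP} [_ [_ [[<- <-] DP]]] := DP.
  exists r, (a ++ alt t u j ++ b); split=> //.
  case: DP => [[rs pE]|[rs [k [y [msr PE pE]]]]]; [left|right]; split=> //.
    exact: mc_trans pE E.
  by exists k, y; split=> //; apply: mc_trans (mc_sym E) PE.
split=> //; exists s, p; split=> //; left; split=> //; exact: mc_refl.
Qed.

Lemma mc_cancel_cat p q z : z ++ p ~ z ++ q -> p ~ q.
Proof. by elim: z => //= s z IH /mc_cancel. Qed.

Lemma mc_lcm s t p q : s != t -> s :: p ~ t :: q ->
  exists k z, [/\ m s t = Some k.+1, p ~ alt t s k ++ z & q ~ alt s t k ++ z].
Proof.
move=> st E; have ds := descent_head s p; have := descent_head t q.
rewrite -(head_mc E) => dt; have [j [mst jd _]] := rank2 hW st ds dt.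
have [k jE] := cox_ge2 hW st mst; subst j.
have [z pz] := factor_head (reduced_altm st mst) jd.
exists k.+1, z; split=> //; first exact: mc_cancel pz.
apply: (@mc_cancel t); apply: mc_trans (mc_sym E) _; apply: mc_trans pz _.
exact: mc_alt.
Qed.

End ArtinWords.

(** * Normal forms of the elements of [W] *)

Section Projection.
Context {d : Order.disp_t} {S : finOrderType d}.
Context {m : S -> S -> option nat} {W : groupType} {gen : S -> W}.
Hypothesis hW : coxeter_group m gen.
Implicit Types (s t r : S) (n k : nat) (u v w x y : W) (p q z : seq S).

Local Notation wprod p := (\prod_(s <- p) gen s).
Local Notation len := (len gen).
Local Notation reduced := (@reduced _ S W gen).
Local Notation descent := (@descent _ S W gen).
Local Notation ladd := (@ladd _ S W gen).
Local Notation piw u := (pi_rec gen (len u) u).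

Lemma first_genP u s : first_gen gen u = Some s <->
  descent s u /\ forall t, descent t u -> (s <= t)%O.
Proof.
rewrite /first_gen; split.
  case: pickP => // s' /andP[du /forallP mn] [<-]; rewrite -(dvd_gen hW).
  by split=> // t; rewrite -(dvd_gen hW) => dt; move: (mn t); rewrite dt.
move=> [du mn]; case: pickP => [s' /andP[du' /forallP mn']|/(_ s)/negP[]].
  congr Some; apply: Order.POrderTheory.le_anti.
  rewrite mn ?andbT -?(dvd_gen hW) //.
  by move: (mn' s); rewrite (dvd_gen hW) du.
by rewrite (dvd_gen hW) du; apply/forallP => t; rewrite (dvd_gen hW); apply/implyP/mn.
Qed.

Lemma first_gen_exists u : u != 1 -> exists s, first_gen gen u = Some s.
Proof.
move=> /(exists_descent hW)[s0 d0].
case: (@Order.TotalTheory.arg_minP _ _ _ s0 (descent^~ u) id d0) => s ds mn.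
by exists s; apply/first_genP; split.
Qed.

Lemma complE s u : compl (gen s) u = gen s * u.
Proof. by rewrite /compl (genV hW). Qed.

Lemma piw1 : piw 1 = [::].
Proof. by rewrite len1. Qed.

Lemma piwE s u : first_gen gen u = Some s -> piw u = s :: piw (gen s * u).
Proof.
move=> us; have /first_genP[ds _] := us.
rewrite (descentY hW ds) /=; case: pickP => [t /eqP ut|_]; last by rewrite us complE.
have : gen t = gen s.
  apply: (dvd_eq hW); rewrite ?(len_gen hW) // -ut (dvd_gen hW) //.
by rewrite ut => /(gen_inj hW) ->; rewrite (genK hW) len1.
Qed.

Lemma wprod_piw u : wprod (piw u) = u.
Proof.
have [n] := ubnP (len u); elim: n u => // n IH u un.
have [->|/first_gen_exists[s us]] := eqVneq u 1; first by rewrite piw1 big_nil.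
rewrite (piwE us) big_cons IH ?(genM hW) //.
by have /first_genP[ds _] := us; move: un; rewrite (descentY hW ds).
Qed.

Lemma size_piw u : size (piw u) = len u.
Proof.
have [n] := ubnP (len u); elim: n u => // n IH u un.
have [->|/first_gen_exists[s us]] := eqVneq u 1; first by rewrite piw1 len1.
have /first_genP[ds _] := us; rewrite (piwE us) [RHS](descentY hW ds) /= IH //.
by move: un; rewrite (descentY hW ds).
Qed.

Lemma reduced_piw u : reduced (piw u).
Proof. by apply/reducedP; rewrite wprod_piw size_piw. Qed.

Lemma first_gen_gen s : first_gen gen (gen s) = Some s.
Proof.
apply/first_genP; rewrite -(dvd_gen hW) dvd_refl; split=> // t.
rewrite -(dvd_gen hW) => ts; suff -> : s = t by [].
by apply/(gen_inj hW)/(dvd_eq hW ts); rewrite !(len_gen hW).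
Qed.

Lemma piw_gen s : piw (gen s) = [:: s].
Proof. by rewrite (piwE (first_gen_gen s)) (genK hW) piw1. Qed.

(** Below length [n] the first letter is the only descent: two descents would force the longest
    element to divide the product. So the order on [S] does not interfere. *)
Lemma piw_alt s t n k : s != t -> m s t = Some n -> k < n ->
  piw (wprod (alt s t k)) = alt s t k.
Proof.
elim: k s t => [|k IH] s t st mst kn; first by rewrite big_nil piw1.
have rk a b j : j <= n -> a != b -> m a b = Some n -> reduced (alt a b j).
  by move=> jn ab mab; apply: (reduced_alt hW ab) => i; rewrite mab => -[<-].
have us : first_gen gen (wprod (alt s t k.+1)) = Some s.
  have ds : descent s (wprod (alt s t k.+1)).
    rewrite /= big_cons (descent_gen hW).
    by have := rk s t k.+1 (ltnW kn) st mst; rewrite /= (reduced_cons hW) => /andP[].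
  apply/first_genP; split=> // r dr; have [->//|sr] := eqVneq s r.
  have rt : r = t.
    have := descent_in_parabolic hW (in_parabolic_alt s t k.+1) dr.
    by rewrite !inE eq_sym (negPf sr) => /eqP.
  rewrite rt in dr; have [j [mst' /dvd_leq nk _]] := rank2 hW st ds dr.
  move: mst' nk; rewrite mst => -[<-].
  rewrite (reducedP _ (rk s t n (leqnn n) st mst)) size_alt.
  by rewrite (reducedP _ (rk s t k.+1 (ltnW kn) st mst)) size_alt leqNgt kn.
rewrite (piwE us) /= big_cons (genM hW) IH // 1?eq_sym // ?(cox_sym hW t) //.
exact: ltnW.
Qed.

End Projection.

(** * Paths as words, and the monoid presented by Artin's 2-polygraph *)

Section PresentedMonoid.
Context {d : Order.disp_t} {S : finOrderType d}.
Context {m : S -> S -> option nat}.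
Hypothesis m_sym : forall s t, m s t = m t s.
Implicit Types (s t r : S) (n k : nat).

Local Notation path := (gpath (@art1 _ S)).
Local Notation "p ~ q" := (mcongruent (artin_relation m) p q) (at level 70).

Fixpoint unword (x y : unit) (p : path x y) : seq S :=
  if p is pcons _ _ _ s q then s :: unword q else [::].

Lemma wordK (p : seq S) : unword (word p) = p.
Proof. by elim: p => //= s p ->. Qed.

Lemma unwordK (p : path tt tt) : word (unword p) = p.
Proof.
suff H x y (q : path x y) :
  match x, y return path x y -> Prop with
  | tt, tt => fun q => word (unword q) = q
  end q by exact: (H tt tt).
by elim: q => [[]|[] [] [] s q /= ->].
Qed.

Lemma unword_cat x y z (p : path x y) (q : path y z) :
  unword (pcat p q) = unword p ++ unword q.
Proof. by elim: p q => //= a b c s p IH q; rewrite IH. Qed.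

Lemma word_cat (p q : seq S) : word (p ++ q) = pcat (word p) (word q).
Proof. by elim: p => //= s p ->. Qed.

Lemma congruent_mc x y (p q : gpath (@cell1 (Art2 m)) x y) :
  congruent p q -> unword p ~ unword q.
Proof.
elim=> {x y p q} [_ _ _ _ [s t n st mst]| x y p|x y p q _|x y p q r _ pq _|].
- by rewrite !wordK; apply/mc_sym/mc_gen; constructor; rewrite ?Order.POrderTheory.lt_eqF.
- exact: mc_refl.
- exact: mc_sym.
- exact: mc_trans.
- by move=> x y z p p' q q' _ pp' _ qq'; rewrite !unword_cat; apply: mc_cat.
Qed.

Lemma tcell_congruent x y (p q : gpath (@cell1 (Art2 m)) x y) :
  tcell p q -> congruent p q.
Proof.
elim=> {x y p q} *; [exact: cg_gen|exact: cg_refl|exact: cg_sym| |exact: cg_cat].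
by apply: cg_trans; eassumption.
Qed.

Lemma mc_tcell (p q : seq S) :
  p ~ q -> inhabited (@tcell (Art2 m) tt tt (word p) (word q)).
Proof.
elim=> {p q} [_ _ [s t n st mst]|p|p q _ [f]|p q r _ [f] _ [g]|p p' q q' _ [f] _ [g]].
- have [lt|lt|eq] := Order.TotalTheory.ltgtP s t; last by rewrite eq eqxx in st.
    exact: inhabits (tinv (gamma lt mst)).
  by rewrite m_sym in mst; exact: inhabits (gamma lt mst).
- exact: inhabits (tid _).
- exact: inhabits (tinv f).
- exact: inhabits (tcomp1 f g).
- by rewrite !word_cat; exact: inhabits (tcomp0 f g).
Qed.

Lemma mc_congruent (p q : path tt tt) :
  unword p ~ unword q -> @congruent (Art2 m) tt tt p q.
Proof. by move=> /mc_tcell[]; rewrite !unwordK; apply: tcell_congruent. Qed.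

Lemma presented_isomorphic :
  isomorphic (presented_category (Art2 m)) (monoid_category (artin_monoid m)).
Proof.
pose F x y (f : phom (P := Art2 m) x y) : artin_monoid m :=
  mclass (artin_relation m) (unword (prepr f)).
have FE x y (p : gpath (@cell1 (Art2 m)) x y) :
    F x y (pclass p) = mclass (artin_relation m) (unword p).
  by apply/mclassP/congruent_mc/prepr_class.
have F1 x : F x x (pclass (pnil x)) = 1 by rewrite FE.
have FM x y z (f : phom (P := Art2 m) x y) (g : phom y z) : F _ _ (Defs.pcomp f g) = F _ _ f * F _ _ g.
  rewrite -(preprK f) -(preprK g) pcompE !FE unword_cat.
  by rewrite -pm_mulE.
exists (@Functor (presented_category (Art2 m)) (monoid_category (artin_monoid m))
  (fun=> tt) F F1 FM); split; first by exists (fun=> tt) => -[].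
move=> [] [].
exists (fun a => pclass (P := Art2 m) (word (mrepr a))) => [f|a] /=.
  rewrite -[RHS]preprK; apply/pclassP/mc_congruent; rewrite wordK.
  exact: mrepr_class.
by rewrite FE wordK; apply: mreprK.
Qed.

End PresentedMonoid.

(** * Two-cells of Artin's presentation *)

Section Cells.
Context {d : Order.disp_t} {S : finOrderType d}.
Context {m : S -> S -> option nat} {W : groupType} {gen : S -> W}.
Hypothesis hW : coxeter_group m gen.
Implicit Types (s t r : S) (n k : nat).

Local Notation path := (gpath (@art1 _ S) tt tt).
Local Notation cell := (@tcell (Art2 m) tt tt).
Local Notation idc := (@tid (Art2 m) tt tt).
Local Notation "p ~ q" := (mcongruent (artin_relation m) p q) (at level 70).
Local Notation "f =h g" := (@cell2_eq (Art3 m gen) tt tt _ _ _ _ f g) (at level 70).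
Local Notation "f \*1 g" := (@tcomp1 (Art2 m) tt tt _ _ _ f g)
  (at level 50, left associativity).
Local Notation "f \*0 g" := (@tcomp0 (Art2 m) tt tt tt _ _ _ _ f g)
  (at level 40, left associativity).
Local Notation "p ** q" := (pcat p q) (at level 40, left associativity).
Implicit Types p q o w z : path.

(** The restriction to cells with the same ends is an equivalence relation on one type, as setoid
    rewriting requires; [=h] is kept for statements that cross a cast. *)
Definition cell_eq p q (f g : cell p q) : Prop := f =h g.
Local Notation "f =c g" := (cell_eq f g) (at level 70).

Lemma cell_eq_refl p q (f : cell p q) : f =c f.
Proof. exact: e_refl. Qed.
#[local] Hint Resolve cell_eq_refl : core.

#[global] Instance cell_eq_equiv p q : Equivalence (@cell_eq p q).
Proof.
split=> [f|f g|f g h]; rewrite /cell_eq; [exact: e_refl|exact: e_sym|exact: e_trans].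
Qed.

#[global] Instance comp1_proper p q o :
  Proper (@cell_eq p q ==> @cell_eq q o ==> @cell_eq p o) (@tcomp1 (Art2 m) tt tt p q o).
Proof. by move=> f f' ff' g g' gg'; apply: e_comp1. Qed.

#[global] Instance comp0_proper p q p' q' :
  Proper (@cell_eq p q ==> @cell_eq p' q' ==> @cell_eq (p ** p') (q ** q'))
    (@tcomp0 (Art2 m) tt tt tt p q p' q').
Proof. by move=> f f' ff' g g' gg'; apply: e_comp0. Qed.

#[global] Instance inv_proper p q :
  Proper (@cell_eq p q ==> @cell_eq q p) (@tinv (Art2 m) tt tt p q).
Proof. by move=> f f' ff'; apply: e_inv. Qed.

Lemma comp1A p q o w (f : cell p q) (g : cell q o) (h : cell o w) :
  f \*1 (g \*1 h) =c f \*1 g \*1 h.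
Proof. exact: e_comp1A. Qed.

Lemma comp1l p q (f : cell p q) : idc p \*1 f =c f.
Proof. exact: e_comp1_idl. Qed.

Lemma comp1r p q (f : cell p q) : f \*1 idc q =c f.
Proof. exact: e_comp1_idr. Qed.

Lemma comp1V p q (f : cell p q) : f \*1 tinv f =c idc p.
Proof. exact: e_invr. Qed.

Lemma compV1 p q (f : cell p q) : tinv f \*1 f =c idc q.
Proof. exact: e_invl. Qed.

Lemma comp1K p q o (f : cell p q) (g : cell q o) : f \*1 g \*1 tinv g =c f.
Proof. by rewrite -comp1A comp1V comp1r. Qed.

Lemma comp1VK p q o (f : cell p q) (g : cell o q) : f \*1 tinv g \*1 g =c f.
Proof. by rewrite -comp1A compV1 comp1r. Qed.

Lemma inv_unique p q (f : cell p q) (g : cell q p) : f \*1 g =c idc p -> g =c tinv f.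
Proof. by move=> fg; rewrite -(comp1l g) -(compV1 f) -comp1A fg comp1r. Qed.

Lemma invK p q (f : cell p q) : tinv (tinv f) =c f.
Proof. by symmetry; apply: inv_unique; rewrite compV1. Qed.

Lemma invM p q o (f : cell p q) (g : cell q o) :
  tinv (f \*1 g) =c tinv g \*1 tinv f.
Proof. by symmetry; apply: inv_unique; rewrite comp1A comp1K comp1V. Qed.

Lemma inv_id p : tinv (idc p) =c idc p.
Proof. by symmetry; apply: inv_unique; rewrite comp1l. Qed.

Lemma comp01 p q o p' q' o' (f : cell p q) (g : cell q o)
    (f' : cell p' q') (g' : cell q' o') :
  (f \*1 g) \*0 (f' \*1 g') =c (f \*0 f') \*1 (g \*0 g').
Proof. exact: e_exchange. Qed.

Lemma comp0_id p q : idc p \*0 idc q =c idc (p ** q).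
Proof. exact: e_comp0_id. Qed.

Lemma comp0_lr p q p' q' (f : cell p q) (g : cell p' q') :
  f \*0 g =c (f \*0 idc p') \*1 (idc q \*0 g).
Proof. by rewrite -comp01 comp1r comp1l. Qed.

Lemma comp0_rl p q p' q' (f : cell p q) (g : cell p' q') :
  f \*0 g =c (idc p \*0 g) \*1 (f \*0 idc q').
Proof. by rewrite -comp01 comp1r comp1l. Qed.

Lemma castE p q p' q' (ep : p = p') (eq : q = q') (f : cell p q) :
  cell_cast ep eq f =h f.
Proof. by case: _ / ep; case: _ / eq; apply: e_refl. Qed.

Definition cns s p : path := @pcons _ (@art1 _ S) tt tt tt s p.

Definition lcell s p q (f : cell p q) : cell (cns s p) (cns s q) :=
  idc (word [:: s]) \*0 f.

#[global] Instance lcell_proper s p q :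
  Proper (@cell_eq p q ==> @cell_eq (cns s p) (cns s q)) (@lcell s p q).
Proof. by move=> f f' ff'; exact: (comp0_proper (cell_eq_refl (idc (word [:: s]))) ff'). Qed.

Lemma lcell_eqh s p q p' q' (f : cell p q) (f' : cell p' q') :
  f =h f' -> lcell s f =h lcell s f'.
Proof. by move=> ff'; exact: (e_comp0 (e_refl (idc (word [:: s]) : Defs.tcell (P := base2 (Art3 m gen)) _ _)) ff'). Qed.

Lemma lcellM s p q o (f : cell p q) (g : cell q o) :
  lcell s (f \*1 g) =c lcell s f \*1 lcell s g.
Proof.
have E := comp0_proper (comp1l (idc (word [:: s]))) (cell_eq_refl (f \*1 g)).
exact: e_trans (e_sym E) (comp01 _ _ _ _).
Qed.

Lemma lcell1 s p : lcell s (idc p) =c idc (cns s p).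
Proof. exact: (comp0_id (word [:: s]) p). Qed.

Lemma lcellV s p q (f : cell p q) : tinv (lcell s f) =c lcell s (tinv f).
Proof. by symmetry; apply: inv_unique; rewrite -lcellM comp1V lcell1. Qed.

Lemma rcell_inv p q w (f : cell p q) : tinv (f \*0 idc w) =c tinv f \*0 idc w.
Proof. by symmetry; apply: inv_unique; rewrite -comp01 comp1V comp1l comp0_id. Qed.

(** Concatenation computes on a leading letter, so this instance of associativity needs no cast. *)
Lemma lcell_id s p q q' (g : cell q q') :
  idc (cns s p) \*0 g =c lcell s (idc p \*0 g).
Proof.
have E := comp0_proper (lcell1 s p) (cell_eq_refl g).
have A := @e_comp0A (Art3 m gen) tt tt tt tt _ _ _ _ _ _ (idc (word [:: s])) (idc p) g.
exact: e_trans (e_sym E) (e_sym A).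
Qed.

Lemma lcell_rcell s p q w (f : cell p q) :
  lcell s f \*0 idc w =c lcell s (f \*0 idc w).
Proof.
have A := @e_comp0A (Art3 m gen) tt tt tt tt _ _ _ _ _ _ (idc (word [:: s])) f (idc w).
exact: e_sym A.
Qed.

Lemma cell_mc p q : cell p q -> unword p ~ unword q.
Proof. by move=> /tcell_congruent/congruent_mc. Qed.

Lemma cell_size p q : cell p q -> size (unword p) = size (unword q).
Proof. by move=> /cell_mc/mc_size. Qed.

Lemma mc_cell p q : unword p ~ unword q -> inhabited (cell p q).
Proof. by move=> /(mc_tcell (cox_sym hW)); rewrite !unwordK. Qed.

Lemma cns_inj s t p q : cns s p = cns t q -> s = t /\ p = q.
Proof.
move=> /(congr1 (@unword _ S _ _)) /= -[-> E]; split=> //.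
by rewrite -(unwordK p) E unwordK.
Qed.

Lemma pathP p : p = pnil tt \/ exists s q, p = cns s q.
Proof.
rewrite -(unwordK p); case: (unword p) => [|s q]; first by left.
by right; exists s, (word q).
Qed.

Definition lt_cases s t (st : s != t) : {(s < t)%O} + {(t < s)%O}.
Proof.
case E: (s < t)%O; first by left.
by right; rewrite Order.TotalTheory.ltNge Order.POrderTheory.le_eqVlt (negPf st) E.
Defined.

Definition crossing s t n (st : s != t) (mst : m s t = Some n) :
    cell (word (alt s t n)) (word (alt t s n)) :=
  match lt_cases st with
  | left lst => tinv (gamma lst mst)
  | right lts => gamma lts (etrans (cox_sym hW t s) mst)
  end.

Lemma crossing_gamma s t n (st : t != s) (lst : (s < t)%O)
    (mst : m s t = Some n) (mts : m t s = Some n) :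
  crossing st mts = gamma lst mst.
Proof.
rewrite /crossing; case: lt_cases => [lts|lst'].
  by have := Order.POrderTheory.lt_trans lts lst; rewrite Order.POrderTheory.ltxx.
by congr gamma; apply: Prop_irrelevance.
Qed.

Lemma crossingV s t n (st : s != t) (mst : m s t = Some n)
    (ts : t != s) (mts : m t s = Some n) :
  tinv (crossing st mst) =c crossing ts mts.
Proof.
have [lst|lts] := lt_cases st.
  rewrite (crossing_gamma ts lst mst mts) /crossing.
  case: lt_cases => [lst'|lts]; last first.
    by have := Order.POrderTheory.lt_trans lst lts; rewrite Order.POrderTheory.ltxx.
  by rewrite invK (Prop_irrelevance lst' lst).
rewrite (crossing_gamma st lts mts mst) /crossing; case: lt_cases => [lts'|lst].
  by rewrite (Prop_irrelevance lts' lts).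
by have := Order.POrderTheory.lt_trans lst lts; rewrite Order.POrderTheory.ltxx.
Qed.

Definition zig s t k (st : s != t) (mst : m s t = Some k.+1) z :
    cell (cns s (word (alt t s k) ** z)) (cns t (word (alt s t k) ** z)) :=
  crossing st mst \*0 idc z.

Lemma zigV s t k (st : s != t) (mst : m s t = Some k.+1)
    (ts : t != s) (mts : m t s = Some k.+1) z :
  zig st mst z \*1 zig ts mts z =c idc _.
Proof.
have E := comp0_proper (crossingV st mst ts mts) (cell_eq_refl (idc z)).
have F := comp1V (zig st mst z); rewrite -[X in _ =c X]F.
apply: comp1_proper => //; symmetry.
exact: e_trans (rcell_inv z (crossing st mst)) E.
Qed.

Lemma zig_natural s t k (st : s != t) (mst : m s t = Some k.+1) z z' (x : cell z z') :
  zig st mst z \*1 lcell t (idc (word (alt s t k)) \*0 x)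
  =c lcell s (idc (word (alt t s k)) \*0 x) \*1 zig st mst z'.
Proof.
have A := lcell_id t (word (alt s t k)) x.
have B := lcell_id s (word (alt t s k)) x.
rewrite -A -B; apply: e_trans (comp0_rl (crossing st mst) x).
exact: e_sym (comp0_lr (crossing st mst) x).
Qed.

(* A 2-cell is direct when it changes the first letter at most once. *)
Inductive direct p q (f : cell p q) : Prop :=
| DirectSame s p' q' (g : cell p' q') of f =h lcell s g
| DirectCross s t k (st : s != t) (mst : m s t = Some k.+1) p' q' z
    (g : cell p' (word (alt t s k) ** z)) (h : cell (word (alt s t k) ** z) q') of
    f =h lcell s g \*1 zig st mst z \*1 lcell t h.

Lemma direct_eqh p q p' q' (f : cell p q) (f' : cell p' q') :
  f =h f' -> direct f -> direct f'.
Proof.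
move=> /e_sym ff' [s a b g fg|s t k st mst a b z g h fg].
  exact: DirectSame (e_trans ff' fg).
exact: DirectCross (e_trans ff' fg).
Qed.

Lemma direct_eq p q (f f' : cell p q) : f =c f' -> direct f -> direct f'.
Proof. exact: direct_eqh. Qed.

Lemma direct_cns p q (f : cell p q) : direct f ->
  exists s p' t q', p = cns s p' /\ q = cns t q'.
Proof.
move=> [s a b g|s t k st mst a b z g h] /cell2_eq_parallel[-> ->].
  by exists s, a, s, b.
by exists s, a, t, b.
Qed.

(** Equal cells have equal ends, so the first letters of the ends decide which constructor
    applies. *)
Lemma direct_sameP s p q (f : cell (cns s p) (cns s q)) : direct f ->
  exists g : cell p q, f =c lcell s g.
Proof.
move=> [a p' q' g fg|a b k ab mab p' q' z g h fg];
  have [E F] := cell2_eq_parallel fg.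
  by have [? ?] := cns_inj E; have [_ ?] := cns_inj F; subst; exists g.
have [? _] := cns_inj E; have [? _] := cns_inj F; subst.
by have := ab; rewrite eqxx.
Qed.

Lemma direct_crossP s t p q (st : s != t) (f : cell (cns s p) (cns t q)) :
  direct f -> exists k (mst : m s t = Some k.+1) z
    (g : cell p (word (alt t s k) ** z)) (h : cell (word (alt s t k) ** z) q),
    f =c lcell s g \*1 zig st mst z \*1 lcell t h.
Proof.
move=> [a p' q' g fg|a b k ab mab p' q' z g h fg];
  have [E F] := cell2_eq_parallel fg.
  have [? _] := cns_inj E; have [? _] := cns_inj F; subst.
  by have := st; rewrite eqxx.
have [? ?] := cns_inj E; have [? ?] := cns_inj F; subst.
by exists k, mab, z, g, h; rewrite (bool_irrelevance st ab).
Qed.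

Lemma direct_lcell s p q (g : cell p q) : direct (lcell s g).
Proof. exact: DirectSame (e_refl _). Qed.

Lemma direct_cross s t k (st : s != t) (mst : m s t = Some k.+1) p q z
    (g : cell p (word (alt t s k) ** z)) (h : cell (word (alt s t k) ** z) q) :
  direct (lcell s g \*1 zig st mst z \*1 lcell t h).
Proof. exact: DirectCross (e_refl _). Qed.

Lemma direct_absorbl s p q o (g : cell p q) (f : cell (cns s q) o) :
  direct f -> direct (lcell s g \*1 f).
Proof.
move=> df; have [_ [_ [t [o' [_ oE]]]]] := direct_cns df; subst o.
have [st|st] := eqVneq s t.
  subst t; have [h fh] := direct_sameP df.
  apply: (@direct_eq _ _ (lcell s (g \*1 h))); last exact: direct_lcell.
  by rewrite fh lcellM.
have [k [mst [z [a [b fE]]]]] := direct_crossP st df.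
apply: direct_eq (direct_cross st mst (g \*1 a) b).
by rewrite fE lcellM !comp1A.
Qed.

Lemma direct_inv p q (f : cell p q) : direct f -> direct (tinv f).
Proof.
move=> df; have [s [p' [t [q' [pE qE]]]]] := direct_cns df; subst p q.
have [st|st] := eqVneq s t.
  subst t; have [h fh] := direct_sameP df.
  by apply: direct_eq (direct_lcell s (tinv h)); rewrite fh lcellV.
have [k [mst [z [a [b fE]]]]] := direct_crossP st df.
have ts : t != s by rewrite eq_sym.
have mts : m t s = Some k.+1 by rewrite (cox_sym hW).
apply: direct_eq (direct_cross ts mts (tinv b) (tinv a)).
rewrite fE !invM !lcellV comp1A; apply: comp1_proper => //; apply: comp1_proper => //.
by apply: inv_unique; rewrite zigV.
Qed.

Lemma direct_absorbr s p q o (f : cell p (cns s q)) (g : cell q o) :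
  direct f -> direct (f \*1 lcell s g).
Proof.
move=> df; apply: (@direct_eq _ _ (tinv (lcell s (tinv g) \*1 tinv f))).
  by rewrite invM invK lcellV invK.
exact/direct_inv/direct_absorbl/direct_inv.
Qed.

(** The crossing absorbs [w] into its right context, which becomes [z ** w] up to the associativity
    casts [ea] and [eb]. *)
Lemma direct_rcell p q w (f : cell p q) : direct f -> direct (f \*0 idc w).
Proof.
move=> df; have [s [p' [t [q' [pE qE]]]]] := direct_cns df; subst p q.
have [st|st] := eqVneq s t.
  subst t; have [h fh] := direct_sameP df.
  apply: direct_eq (direct_lcell s (h \*0 idc w)).
  by rewrite -lcell_rcell fh.
have [k [mst [z [a [b fE]]]]] := direct_crossP st df.
have ea : word (alt t s k) ** z ** w = word (alt t s k) ** (z ** w) by rewrite pcatA.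
have eb : word (alt s t k) ** z ** w = word (alt s t k) ** (z ** w) by rewrite pcatA.
apply: direct_eqh (direct_cross st mst (cell_cast erefl ea (a \*0 idc w))
  (cell_cast eb erefl (b \*0 idc w))).
have ww : idc w =c idc w \*1 idc w by rewrite comp1l.
have E : f \*0 idc w =c
    (lcell s a \*0 idc w) \*1 (zig st mst z \*0 idc w) \*1 (lcell t b \*0 idc w).
  by rewrite -!comp01 fE !comp1l.
apply: e_sym; apply: e_trans E _.
apply: (@e_comp1 (Art3 m gen)).
  apply: (@e_comp1 (Art3 m gen)).
    apply: e_trans (lcell_rcell s w a) _; apply: lcell_eqh.
    exact: e_sym (castE _ _ _).
  have A := @e_comp0A (Art3 m gen) tt tt tt tt _ _ _ _ _ _ (crossing st mst) (idc z) (idc w).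
  exact: e_trans (e_sym A) (comp0_proper (cell_eq_refl (crossing st mst)) (comp0_id z w)).
apply: e_trans (lcell_rcell t w b) _; apply: lcell_eqh.
exact: e_sym (castE _ _ _).
Qed.

(** Left cancellation settles equal letters; for distinct ones, both words factor through the lcm
    with a common tail. *)
Lemma direct_exists s p t q : unword (cns s p) ~ unword (cns t q) ->
  exists f : cell (cns s p) (cns t q), direct f.
Proof.
rewrite /=; have [<-|st] := eqVneq s t.
  move=> /(mc_cancel hW)/mc_cell[g]; exists (lcell s g); exact: direct_lcell.
move=> /(mc_lcm hW st)[k [z [mst pz qz]]].
have [g] : inhabited (cell p (word (alt t s k) ** word z)).
  by apply: mc_cell; rewrite -word_cat wordK.
have [h] : inhabited (cell (word (alt s t k) ** word z) q).
  by apply: mc_cell; rewrite -word_cat wordK; apply: mc_sym.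
exact: ex_intro (direct_cross st mst g h).
Qed.

Lemma cell_ind (P : forall p q, cell p q -> Prop) :
    (forall s t n (lst : (s < t)%O) (mst : m s t = Some n), P _ _ (gamma lst mst)) ->
    (forall p, P _ _ (idc p)) ->
    (forall p q (f : cell p q), P _ _ f -> P _ _ (tinv f)) ->
    (forall p q o (f : cell p q) (g : cell q o),
       P _ _ f -> P _ _ g -> P _ _ (f \*1 g)) ->
    (forall p q p' q' (f : cell p q) (g : cell p' q'),
       P _ _ f -> P _ _ g -> P _ _ (f \*0 g)) ->
  forall p q (f : cell p q), P p q f.
Proof.
move=> Pg Pi Pv P1 P0.
suff H x y (p q : gpath (@cell1 (Art2 m)) x y) (f : tcell p q) :
    match x, y return forall p q : gpath (@cell1 (Art2 m)) x y, tcell p q -> Prop with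
    | tt, tt => P end p q f by exact: (H tt tt).
elim: f => {x y p q} [_ _ _ _ [s t k lst mst]|[] []|[] []|[] []|[] [] []] //=.
- exact: Pg.
- by move=> *; apply: P1.
- by move=> *; apply: P0.
Qed.

(** Generating 2-cells have sources of length at least two, so only identities live on the empty
    word. *)
Lemma cell_nil p q (f : cell p q) : unword p = [::] -> f =h idc p.
Proof.
elim/cell_ind: p q / f => [s t k lst mst|p|p q f IH|p q o f g IHf IHg|p q p' q' f g IHf IHg].
- have [|j kE] := cox_ge2 hW _ mst; first by rewrite Order.POrderTheory.lt_eqF.
  by subst k; rewrite wordK.
- by move=> _; apply: e_refl.
- move=> q0; have p0 : unword p = [::].
    by apply/nilP; rewrite /nilp (cell_size f) q0.
  have [_ qp] := cell2_eq_parallel (IH p0); subst q.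
  by apply: e_trans (e_inv (IH p0)) _; apply: inv_id.
- move=> p0; have [_ qp] := cell2_eq_parallel (IHf p0); subst q.
  by apply: e_trans (e_comp1 (IHf p0) (IHg p0)) _; apply: e_comp1_idl.
- rewrite unword_cat; case E: (unword p) => // E'.
  have E0 := @e_comp0 (Art3 m gen) tt tt tt _ _ _ _ _ _ _ _ _ _ _ _ (IHf E) (IHg E').
  exact: e_trans E0 (comp0_id p p').
Qed.

(** * The induction step on the length of the source *)

Section Step.
Variable n : nat.
Hypothesis coherent_below :
  forall p q (f g : cell p q), size (unword p) < n -> f =c g.

Lemma cross_middle s t k z z' (w : path)
    (a : cell w (word (alt s t k) ** z)) (b : cell w (word (alt s t k) ** z')) :
  inhabited (cell z z').
Proof.
apply: mc_cell; apply: (mc_cancel_cat hW (z := alt s t k)).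
have := mc_trans (mc_sym (cell_mc a)) (cell_mc b).
by rewrite !unword_cat !wordK.
Qed.

(** Two crossings between the same letters differ by a cell [x] between their right contexts. The
    cells behind the first letters have shorter sources, hence are determined, and [x] slides
    through the crossing. *)
Lemma direct_unique p q (f f' : cell p q) : size (unword p) <= n ->
  direct f -> direct f' -> f =c f'.
Proof.
move=> pn df df'; have [s [p' [t [q' [pE qE]]]]] := direct_cns df; subst p q.
have [st|st] := eqVneq s t.
  subst t; have [g ->] := direct_sameP df; have [g' ->] := direct_sameP df'.
  by apply: lcell_proper; apply: coherent_below.
have [k [mst [z [a [b fE]]]]] := direct_crossP st df.
have [k' [mst' [z' [a' [b' fE']]]]] := direct_crossP st df'.
have kk : k' = k by have := mst'; rewrite mst => -[].
subst k'; rewrite (Prop_irrelevance mst' mst) in fE' *.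
have [x] := cross_middle a a'.
have aE : a' =c a \*1 (idc (word (alt t s k)) \*0 x) by apply: coherent_below.
have bE : b =c (idc (word (alt s t k)) \*0 x) \*1 b'.
  by apply: coherent_below; rewrite (cell_size b); move: pn; rewrite (cell_size f).
rewrite fE fE' aE bE !lcellM !comp1A; apply: comp1_proper => //.
by rewrite -!comp1A; apply: comp1_proper => //; apply: zig_natural.
Qed.

(** Between the two opposite crossings, the cell behind [t] may be taken to act on the right context
    only; it slides out, and the crossings cancel. *)
Lemma direct_turn s t p q o (f : cell (cns s p) (cns t q)) (g : cell (cns t q) (cns s o)) :
  s != t -> size (unword (cns s p)) <= n -> direct f -> direct g -> direct (f \*1 g).
Proof.
move=> st pn df dg; have ts : t != s by rewrite eq_sym.
have [k [mst [z [a [b fE]]]]] := direct_crossP st df.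
have [k' [mts [z' [a' [b' gE]]]]] := direct_crossP ts dg.
have kk : k' = k by have := mts; rewrite (cox_sym hW) mst => -[].
subst k'; have [x] := cross_middle (tinv b) a'.
have E : b \*1 a' =c idc (word (alt s t k)) \*0 x.
  by apply: coherent_below; rewrite (cell_size b); move: pn; rewrite (cell_size f).
apply: (@direct_eq _ _ (lcell s (a \*1 (idc (word (alt t s k)) \*0 x) \*1 b'))).
  rewrite fE gE !lcellM !comp1A; apply: comp1_proper => //.
  rewrite -!comp1A; apply: comp1_proper => //.
  rewrite (comp1A (lcell t b)) -lcellM E (comp1A (zig st mst z)) zig_natural.
  by rewrite -comp1A zigV comp1r.
exact: direct_lcell.
Qed.

(** The one case that rests on 3-cells, isolated here and proved once the cells pi(alpha) are
    known. *)
Hypothesis triangle : forall s t r p q o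
    (f : cell (cns s p) (cns t q)) (g : cell (cns t q) (cns r o)),
  uniq [:: s; t; r] -> size (unword (cns s p)) <= n ->
  direct f -> direct g -> direct (f \*1 g).

Lemma direct_comp p q o (f : cell p q) (g : cell q o) :
  size (unword p) <= n -> direct f -> direct g -> direct (f \*1 g).
Proof.
move=> pn df dg; have [s [p' [t [q' [pE qE]]]]] := direct_cns df; subst p q.
have [_ [_ [r [o' [_ oE]]]]] := direct_cns dg; subst o.
have [st|st] := eqVneq s t.
  subst t; have [h fh] := direct_sameP df.
  by apply: (@direct_eq _ _ (lcell s h \*1 g)); [rewrite fh|apply: direct_absorbl].
have [tr|tr] := eqVneq t r.
  subst r; have [h gh] := direct_sameP dg.
  by apply: (@direct_eq _ _ (f \*1 lcell t h)); [rewrite gh|apply: direct_absorbr].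
have [sr|sr] := eqVneq s r; first by subst r; apply: direct_turn.
by apply: triangle => //=; rewrite !inE negb_or st sr tr.
Qed.

Lemma direct_gamma s t k (lst : (s < t)%O) (mst : m s t = Some k) :
  direct (gamma lst mst).
Proof.
have ts : t != s by rewrite eq_sym Order.POrderTheory.lt_eqF.
have mts : m t s = Some k by rewrite (cox_sym hW).
have [j kE] := cox_ge2 hW ts mts; subst k.
rewrite -(crossing_gamma ts lst mst mts).
have := direct_cross ts mts (idc _) (idc (word (alt t s j.+1) ** pnil tt)).
apply: direct_eqh.
have E : lcell t (idc _) \*1 zig ts mts (pnil tt) \*1 lcell s (idc _) =c zig ts mts (pnil tt).
  by rewrite !lcell1 comp1l comp1r.
exact: e_trans E (@e_comp0_idr (Art3 m gen) tt tt _ _ (crossing ts mts)).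
Qed.

Lemma cell_direct p q (f : cell p q) :
  size (unword p) <= n -> unword p != [::] -> direct f.
Proof.
elim/cell_ind: p q / f => [s t k lst mst|p|p q f IH|p q o f g IHf IHg|p q p' q' f g IHf IHg].
- by move=> _ _; apply: direct_gamma.
- move=> _; have [->//|[s [p' ->]]] := pathP p.
  by move=> _; apply: direct_eq (lcell1 s p') _; apply: direct_lcell.
- rewrite -(cell_size f) => pn q0; apply/direct_inv/IH => //.
  by move: q0; rewrite -!size_eq0 (cell_size f).
- move=> pn p0; apply: direct_comp => //; first exact: IHf.
  by apply: IHg; rewrite -?size_eq0 -(cell_size f) // size_eq0.
- rewrite unword_cat size_cat => pn; have [E|pne] := eqVneq (unword p) [::].
    rewrite E => p0; have fE := cell_nil f E.
    have pE : p = pnil tt by rewrite -(unwordK p) E.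
    apply: (@direct_eqh _ _ _ _ g).
      have E0 := @e_comp0 (Art3 m gen) tt tt tt _ _ _ _ _ _ _ _ _ _ _ _ fE (@e_refl (Art3 m gen) tt tt _ _ g).
      apply: e_sym; apply: e_trans E0 _; rewrite pE.
      exact: (@e_comp0_idl (Art3 m gen) tt tt _ _ g).
    by apply: IHg => //; apply: leq_trans pn; apply: leq_addl.
  move=> _; have df : direct f by apply: IHf => //; apply: leq_trans pn; apply: leq_addr.
  (* By exchange, [g] is performed after [f], where it lies behind the first letter of [q] and is
     absorbed. *)
  apply: (@direct_eq _ _ ((f \*0 idc p') \*1 (idc q \*0 g))); first by rewrite -comp0_lr.
  have [_ [_ [t [q1 [_ qE]]]]] := direct_cns df; subst q.
  apply: (@direct_eq _ _ ((f \*0 idc p') \*1 lcell t (idc q1 \*0 g))).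
    by apply: comp1_proper => //; symmetry; apply: lcell_id.
  exact: (@direct_absorbr t _ (q1 ** p') _ (f \*0 idc p') _ (direct_rcell p' df)).
Qed.

Lemma coherent_step p q (f g : cell p q) : size (unword p) <= n -> f =c g.
Proof.
move=> pn; have [E|p0] := eqVneq (unword p) [::].
  exact: e_trans (cell_nil f E) (e_sym (cell_nil g E)).
by apply: direct_unique => //; apply: cell_direct.
Qed.

End Step.
End Cells.

(** * Zamolodchikov cells *)

Section CoherentPresentation.
Context {d : Order.disp_t} {S : finOrderType d}.
Context {m : S -> S -> option nat} {W : groupType} {gen : S -> W}.
Hypothesis hW : coxeter_group m gen.
Implicit Types (s t r : S) (n k : nat) (u v w x y : W) (P : seq S).

Local Notation wprod p := (\prod_(s <- p) gen s).
Local Notation len := (len gen).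
Local Notation reduced := (@reduced _ S W gen).
Local Notation descent := (@descent _ S W gen).
Local Notation ladd := (@ladd _ S W gen).
Local Notation path := (gpath (@art1 _ S) tt tt).
Local Notation "p ~ q" := (mcongruent (artin_relation m) p q) (at level 70).
Local Notation cell := (@tcell (Art2 m) tt tt).
Local Notation idc := (@tid (Art2 m) tt tt).
Local Notation "f =h g" := (@cell2_eq (Art3 m gen) tt tt _ _ _ _ f g) (at level 70).
Local Notation "f =c g" := (@cell_eq _ S m W gen _ _ f g) (at level 70).
Local Notation "f \*1 g" := (@tcomp1 (Art2 m) tt tt _ _ _ f g)
  (at level 50, left associativity).
Local Notation "f \*0 g" := (@tcomp0 (Art2 m) tt tt tt _ _ _ _ f g)
  (at level 40, left associativity).
Local Notation "p ** q" := (pcat p q) (at level 40, left associativity).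
Local Notation direct := (direct hW).
Local Notation "''pi' u" := (pi_ gen u) (at level 8, u at level 2).
Local Notation alpha u v f := (@pi_alpha _ S W m gen u v f).

Lemma direct_cast p q p' q' (ep : p = p') (eq : q = q') (f : cell p q) :
  direct f -> direct (cell_cast ep eq f).
Proof. by case: _ / ep; case: _ / eq. Qed.

Lemma direct_comp_samer s p q q' o o' (f : cell p q) (g : cell q o) :
  q = cns s q' -> o = cns s o' -> direct f -> direct g -> direct (f \*1 g).
Proof.
move=> qE oE; subst q o => df dg; have [h fh] := direct_sameP dg.
apply: direct_eq (direct_absorbr h df).
apply: comp1_proper; [exact: e_refl|exact: e_sym fh].
Qed.

Lemma direct_id s p p' : p = cns s p' -> direct (idc p).
Proof. by move=> ->; apply: direct_eq (lcell1 s p') (direct_lcell _ _ _). Qed.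

Lemma pi_cns s u : first_gen gen u = Some s -> 'pi u = cns s ('pi (compl (gen s) u)).
Proof. by move=> us; rewrite /pi_ (piwE hW us) (complE hW). Qed.

Lemma pi_gen s : 'pi (gen s) = word [:: s].
Proof. by rewrite /pi_ (piw_gen hW). Qed.

(** In the splitting clause the first factor acts behind the letter [s], so only the second must be
    direct. *)
Lemma alpha_step u v s (u' := compl (gen s) u) :
    first_gen gen u = Some s -> (forall t, u <> gen t) ->
    (exists f, alpha u' v f) ->
    (exists2 g, alpha (gen s) (u' * v) g & direct g) ->
  exists2 f, alpha u v f & direct f.
Proof.
move=> us uS [f af] [g ag dg].
have e : 'pi (gen s) ** 'pi (u' * v) = word [:: s] ** 'pi (u' * v) by rewrite pi_gen.
have e1 : word [:: s] ** ('pi u' ** 'pi v) = 'pi u ** 'pi v by rewrite (pi_cns us).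
have e2 : 'pi (gen s * (u' * v)) = 'pi (u * v).
  by rewrite mulgA /u' /compl mulVKg.
exists (cell_cast e1 e2 ((idc (word [:: s]) \*0 f) \*1 cell_cast e erefl g)).
  exact: alpha_split af ag.
apply: direct_cast; apply: (@direct_absorbl _ _ _ _ _ hW s _ ('pi (u' * v)) _ f).
exact: direct_cast.
Qed.

Lemma alpha_same s v : first_gen gen (gen s * v) = Some s ->
  exists2 f, alpha (gen s) v f & direct f.
Proof.
move=> sv; have e : 'pi (gen s * v) = 'pi (gen s) ** 'pi v.
  by rewrite pi_gen (pi_cns sv) (complE hW) (genM hW).
exists (cell_cast e erefl (idc ('pi (gen s * v)))); first exact: alpha_id.
by apply: direct_cast; apply: direct_id (pi_cns sv).
Qed.

Lemma pi_w0_pair r s n : (r < s)%O -> m r s = Some n ->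
  'pi (w0 gen [set r; s]%SET) = word (alt r s n).
Proof.
move=> lrs mrs; have rs : r != s by rewrite Order.POrderTheory.lt_eqF.
have sr : s != r by rewrite eq_sym.
have msr : m s r = Some n by rewrite (cox_sym hW).
have [k nk] := cox_ge2 hW rs mrs; subst n.
rewrite (w0_pair hW rs mrs) /pi_.
have ds a b : a != b -> m a b = Some k.+2 -> descent a (wprod (alt a b k.+2)).
  move=> ab mab; have := reduced_altm hW ab mab.
  by rewrite /= big_cons (descent_gen hW) (reduced_cons hW) big_cons => /andP[].
have fg : first_gen gen (wprod (alt r s k.+2)) = Some r.
  apply/(first_genP hW); split=> [|a /(descent_in_parabolic hW (in_parabolic_alt r s _))].
    exact: ds.
  by rewrite !inE => /orP[]/eqP-> //; apply: Order.POrderTheory.ltW.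
rewrite (piwE hW fg) -[alt r s k.+2]/(r :: alt s r k.+1) big_cons (genM hW).
by rewrite (piw_alt hW sr msr).
Qed.

Lemma pi_compl_w0 r s n : (r < s)%O -> m r s = Some n.+1 ->
  'pi (compl (gen s) (w0 gen [set r; s]%SET)) = word (alt r s n).
Proof.
move=> lrs mrs; have rs : r != s by rewrite Order.POrderTheory.lt_eqF.
rewrite (w0_pair hW rs mrs) (wprod_alt hW mrs) /= big_cons (complE hW) (genM hW).
by rewrite /pi_ (piw_alt hW rs mrs).
Qed.

(** In the last clause, the first factor acts behind [s], [gamma] turns [s] into [r], and the third
    factor has both ends starting with [r]: the first letter changes once. *)
Lemma alpha_cross s v r : ladd (gen s) v -> first_gen gen (gen s * v) = Some r ->
    r != s ->
    (forall x y, x != 1 -> ladd x y -> len (x * y) < len (gen s * v) ->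
       exists2 f, alpha x y f & direct f) ->
  exists2 f, alpha (gen s) v f & direct f.
Proof.
move=> sv rw rs IH; have /(first_genP hW)[dr mn] := rw.
have ds : descent s (gen s * v) by rewrite -(dvd_gen hW) dvd_ladd.
have lrs : (r < s)%O by rewrite Order.POrderTheory.lt_neqAle rs mn.
have [n [mrs Dw _]] := rank2 hW rs dr ds.
have [k nk] := cox_ge2 hW rs mrs; subst n.
have wE := w0_pair hW rs mrs; rewrite -wE in Dw.
have piw0 := pi_w0_pair lrs mrs; have pix := pi_compl_w0 lrs mrs.
have [E|/eqP E] := eqVneq (gen s * v) (w0 gen [set r; s]%SET).
  have e1 : word (alt s r k.+2) = 'pi (gen s) ** 'pi v.
    by rewrite -[v](genM hW s) E -(complE hW) pix pi_gen.
  have e2 : word (alt r s k.+2) = 'pi (gen s * v) by rewrite E.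
  exists (cell_cast e1 e2 (gamma lrs mrs)); first exact: alpha_gamma.
  exact/direct_cast/direct_gamma.
pose x := compl (gen s) (w0 gen [set r; s]%SET); pose y := compl x v.
have sxE : gen s * x = w0 gen [set r; s]%SET by rewrite /x /compl mulVKg.
have xyE : x * y = v by rewrite /y /compl mulVKg.
have wlen : len (w0 gen [set r; s]%SET) = k.+2.
  by rewrite wE (reducedP _ (reduced_altm hW rs mrs)) size_alt.
have Ldw a : a \in [set r; s]%SET -> descent a (w0 gen [set r; s]%SET).
  apply: (w0_descent hW (w := gen s * v)) => b.
  by rewrite !inE => /orP[]/eqP->.
have ladd_compl a : a \in [set r; s]%SET ->
    ladd (gen a) (compl (gen a) (w0 gen [set r; s]%SET)).
  by move=> aI; rewrite -dvd_ladd /compl mulVKg (dvd_gen hW) Ldw.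
have sI : s \in [set r; s]%SET by rewrite !inE eqxx orbT.
have rI : r \in [set r; s]%SET by rewrite !inE eqxx.
have Lwy : ladd (w0 gen [set r; s]%SET) y.
  by rewrite -dvd_ladd -{2}sxE -mulgA xyE.
have Lsxy : ladd (gen s * x) y by rewrite sxE.
have neq1 a : a \in [set r; s]%SET -> compl (gen a) (w0 gen [set r; s]%SET) != 1.
  move=> aI; have := ladd_compl a aI; move/laddP.
  rewrite /compl mulVKg wlen (len_gen hW) -(len_eq0 hW) => E1.
  by apply/eqP => E2; rewrite E2 in E1.
have lenw : len (gen s * v) = (len v).+1 by rewrite (laddP _ _ sv) (len_gen hW).
have [_ Lxy] : ladd (gen s) (x * y) /\ ladd x y.
  by have := Lsxy; rewrite (laddA hW) ?ladd_compl // => /andP[].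
have [f af _] : exists2 f, alpha x y f & direct f.
  by apply: IH => //; [apply: neq1|rewrite xyE lenw].
have rw0 : first_gen gen (gen s * x) = Some r.
  apply/(first_genP hW); rewrite sxE; split; first exact: Ldw.
  by move=> a da; apply: mn; apply: (descent_dvd hW da).
(* The product here is still [gen s * v], too long for [IH]. One splitting leaves a shorter product
   and a cell for the letter [r], which is an identity because [r] is the first generator of
   [gen s * v]. *)
have [g ag dg] : exists2 g, alpha (gen s * x) y g & direct g.
  apply: (alpha_step rw0).
  - move=> t E1; have := wlen; rewrite -sxE E1 (len_gen hW) => //.
  - have Lr : ladd (gen r) (compl (gen r) (gen s * x)) by rewrite sxE ladd_compl.
    have := Lsxy; rewrite -{1}[gen s * x](mulVKg (gen r)) (laddA hW _ Lr).
    move=> /andP[L1 L2]; have [f' af' _] : exists2 f, alpha (compl (gen r) (gen s * x)) y f & direct f.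
      apply: IH => //; first by rewrite sxE neq1.
      have := laddP _ _ L1; rewrite (len_gen hW) mulgA /compl mulVKg -mulgA xyE => ->.
      by rewrite add1n ltnS.
    by exists f'.
  - by apply: alpha_same; rewrite mulgA /compl mulVKg -mulgA xyE.
have e : word (alt s r k.+2) ** 'pi y = word [:: s] ** ('pi x ** 'pi y).
  by rewrite pix.
have e' : 'pi (gen s * x) ** 'pi y = word (alt r s k.+2) ** 'pi y.
  by rewrite sxE piw0.
have e1 : word [:: s] ** 'pi (x * y) = 'pi (gen s) ** 'pi v.
  by rewrite pi_gen xyE.
have e2 : 'pi (gen s * x * y) = 'pi (gen s * v) by rewrite -mulgA xyE.
exists (cell_cast e1 e2 (((idc (word [:: s]) \*0 tinv f)
   \*1 cell_cast e erefl (gamma lrs mrs \*0 idc ('pi y))) \*1 cell_cast e' erefl g)).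
  exact: (@alpha_gen _ S W m gen s v r k.+2 lrs mrs f g).
apply: direct_cast.
apply: (@direct_comp_samer r _ _ (word (alt s r k.+1) ** 'pi y) _
          ('pi (compl (gen r) (gen s * x * y)))) => //.
- by rewrite -pi_cns // -mulgA xyE.
- apply: (@direct_absorbl _ _ _ _ _ hW s _ ('pi x ** 'pi y) _ (tinv f)).
  exact/direct_cast/direct_rcell/direct_gamma.
- exact: direct_cast.
Qed.

(** The recursion descends on the length of [u * v]. Splitting keeps this length in its second call,
    whose first argument is a generator; hence [single] is established first. *)
Lemma alpha_exists u v : u != 1 -> ladd u v ->
  exists2 f, alpha u v f & direct f.
Proof.
have [n] := ubnP (len (u * v)); elim: n u v => // n IH u v uvn u1 uv.
have single s y : ladd (gen s) y -> len (gen s * y) = len (u * v) ->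
    exists2 f, alpha (gen s) y f & direct f.
  move=> sy E; have [r ry] : exists r, first_gen gen (gen s * y) = Some r.
    apply: (first_gen_exists hW); rewrite -(len_eq0 hW) (laddP _ _ sy) (len_gen hW) //.
  have [rs|rs] := eqVneq r s; first by apply: alpha_same; rewrite ry rs.
  apply: alpha_cross sy ry rs _ => x z x1 xz lt; apply: IH => //.
  by rewrite E in lt; apply: leq_trans lt _; rewrite -ltnS.
have [[t ut]|uS] := pselect (exists t, u = gen t).
  by subst u; apply: single.
have [s us] := first_gen_exists hW u1.
have /(first_genP hW)[ds _] := us.
have uE : gen s * compl (gen s) u = u by rewrite /compl mulVKg.
have Ls : ladd (gen s) (compl (gen s) u) by rewrite -dvd_ladd uE (dvd_gen hW).
have := uv; rewrite -{1}uE (laddA hW _ Ls) => /andP[L1 L2].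
have E : gen s * (compl (gen s) u * v) = u * v by rewrite mulgA uE.
apply: (alpha_step us) => [t ut||].
- by apply: uS; exists t.
- have [f af _] : exists2 f, alpha (compl (gen s) u) v f & direct f.
    apply: IH => //.
      by have := laddP _ _ L1; rewrite E (len_gen hW) => E'; move: uvn; rewrite E'.
    by apply/eqP => c1; apply: uS; exists s; rewrite -uE c1 mulg1.
  by exists f.
- by apply: single; rewrite ?E.
Qed.

#[local] Hint Resolve cell_eq_refl : core.

(** The target of the 3-cell is a cell behind [t] followed by the direct cell pi(alpha_(t,uv)),
    hence direct. So its source, a crossing from [t] to [s] followed by a direct cell from [s] to
    [r], is direct too. *)
Lemma zamolodchikov r s t w : (r < s)%O -> (s < t)%O ->
    (forall a, a \in [set r; s; t]%SET -> descent a w) ->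
  exists p q o (f : cell (cns t p) (cns s q)) (g : cell (cns s q) (cns r o)),
    [/\ reduced (unword (cns t p)),
        wprod (unword (cns t p)) = w0 gen [set r; s; t]%SET,
        direct f, direct g & direct (f \*1 g)].
Proof.
move=> lrs lst dw; set I := [set r; s; t]%SET; set W0 := w0 gen I.
have [rI sI tI] : [/\ r \in I, s \in I & t \in I] by rewrite !inE !eqxx !orbT.
have dW a : a \in I -> descent a W0 := w0_descent hW dw.
have st : s != t by rewrite Order.POrderTheory.lt_eqF.
have [n [mst vW _]] := rank2 hW st (dW _ sI) (dW _ tI).
have [k nk] := cox_ge2 hW st mst; subst n.
have vE := w0_pair hW st mst; rewrite -vE in vW.
have piv := pi_w0_pair lst mst; have piu := pi_compl_w0 lst mst.
pose u := compl (gen t) (w0 gen [set s; t]%SET).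
pose v := compl (w0 gen [set s; t]%SET) W0.
have tuE : gen t * u = w0 gen [set s; t]%SET by rewrite /u /compl mulVKg.
have tuvE : gen t * u * v = W0 by rewrite tuE /v /compl mulVKg.
have vlen : len (w0 gen [set s; t]%SET) = k.+2.
  by rewrite vE (reducedP _ (reduced_altm hW st mst)) size_alt.
have Ltuv : ladd (gen t * u) v by rewrite -dvd_ladd tuvE tuE.
have Ltu : ladd (gen t) u.
  rewrite -dvd_ladd tuE (dvd_gen hW) (w0_descent hW (w := W0)) ?inE ?eqxx ?orbT //.
  by move=> a; rewrite !inE => /orP[]/eqP->; apply: dW.
have := Ltuv; rewrite (laddA hW _ Ltu) => /andP[Lt_uv Luv].
have u1 : u != 1.
  apply/eqP => u1; have := laddP _ _ Ltu.
  by rewrite tuE vlen u1 len1 (len_gen hW).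
have gen1 a : gen a != 1 by rewrite -(len_eq0 hW) (len_gen hW).
have tu1 : gen t * u != 1 by rewrite tuE -(len_eq0 hW) vlen.
have [f af df] := alpha_exists tu1 Ltuv.
have [g ag dg] := alpha_exists u1 Luv.
have [h ah dh] := alpha_exists (gen1 t) Lt_uv.
have e : 'pi (gen t * u) ** 'pi v = word (alt s t k.+2) ** 'pi v by rewrite tuE piv.
have e' : 'pi (gen t) ** 'pi (u * v) = word [:: t] ** 'pi (u * v).
  by rewrite pi_gen.
have e1 : word [:: t] ** ('pi u ** 'pi v) = word (alt t s k.+2) ** 'pi v by rewrite piu.
have e2 : 'pi (gen t * (u * v)) = 'pi (gen t * u * v) by rewrite mulgA.
have fin : finite_set (parabolic gen [set r; s; t]%SET) := finite_parabolic hW dw.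
have Z := @Zcell _ S W m gen r s t k.+2 lrs lst mst f g h e e' e1 e2 fin af ag ah.
have dA : direct ((gamma lst mst \*0 idc ('pi v)) \*1 cell_cast e erefl f).
  apply: direct_eqh (e_sym (@e_cell3 (Art3 m gen) _ _ _ _ _ _ Z)) _.
  apply: direct_cast.
  apply: (@direct_absorbl _ _ _ _ _ hW t _ ('pi (u * v)) _ g).
  exact: direct_cast.
(* [r] is the least letter of [I], and the descents of [W0] lie in [I], so the common target begins
   with [r]. *)
have rW : first_gen gen (gen t * u * v) = Some r.
  rewrite tuvE; apply/(first_genP hW); split; first exact: dW.
  have [IW _] := w0_max hW dW.
  move=> a /(descent_in_parabolic hW IW); rewrite !inE => /orP[/orP[]|]/eqP-> //.
    exact: Order.POrderTheory.ltW.
  exact/Order.POrderTheory.ltW/(Order.POrderTheory.lt_trans lrs).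
have oE := pi_cns rW.
have dg1 : direct (gamma lst mst \*0 idc ('pi v)) by apply/direct_rcell/direct_gamma.
have df1 : direct (cell_cast e oE f) by apply: direct_cast.
have E : cell_cast e oE f =h cell_cast e erefl f.
  exact: e_trans (castE (gen := gen) e oE f) (e_sym (castE (gen := gen) e erefl f)).
have wE : unword (word (alt t s k.+2) ** 'pi v) = alt t s k.+2 ++ pi_rec gen (len v) v.
  by rewrite unword_cat !wordK.
have mts : m t s = Some k.+2 by rewrite (cox_sym hW).
have wp : wprod (alt t s k.+2) = gen t * u by rewrite -(wprod_alt hW mst) tuE vE.
exists (word (alt s t k.+1) ** 'pi v), (word (alt t s k.+1) ** 'pi v),
  ('pi (compl (gen r) (gen t * u * v))),
  (gamma lst mst \*0 idc ('pi v)), (cell_cast e oE f); split=> //.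
- rewrite [unword _]wE reduced_cat_ladd; last exact: (reduced_piw hW).
    by rewrite wp (wprod_piw hW).
  by apply: (reduced_altm hW _ mts); rewrite eq_sym.
- by rewrite [unword _]wE wprod_cat wp (wprod_piw hW) tuvE.
- apply: direct_eqh dA; apply: (@e_comp1 (Art3 m gen)); first exact: e_refl.
  exact: e_sym.
Qed.

(** * Triangles of direct cells between three distinct letters *)

Section Fill.
Variable n : nat.
Hypothesis coherent_below :
  forall p q (f g : cell p q), size (unword p) < n -> f =c g.

(** The condition on the source involves only the braid class of [P], and can thus be moved to any
    corner of the triangle. *)
Definition fills P s t r := forall p q o
    (f : cell (cns s p) (cns t q)) (g : cell (cns t q) (cns r o)),
  unword (cns s p) ~ P -> direct f -> direct g -> direct (f \*1 g).

Lemma fills_rev P s t r : fills P s t r -> fills P r t s.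
Proof.
move=> str p q o f g pP df dg.
apply: (@direct_eq _ _ _ _ _ hW _ _ (tinv (tinv g \*1 tinv f))).
  by rewrite -invM invK.
apply/direct_inv/str; [|exact: direct_inv|exact: direct_inv].
by apply: mc_trans pP; apply: cell_mc; exact: tinv (f \*1 g).
Qed.

(** Closing the triangle with a direct cell [h], the known case and uniqueness give [f] as [h]
    followed by the inverse of [g]; solving for [h] exhibits the wanted composite. *)
Lemma fills_swap P s t r : size P <= n -> fills P s t r -> fills P s r t.
Proof.
move=> Pn str p q o f g pP df dg.
have [h dh] : exists h : cell (cns s p) (cns t o), direct h.
  exact/direct_exists/cell_mc/(f \*1 g).
have fE : f =c h \*1 tinv g.
  apply: (direct_unique coherent_below _ df); first by rewrite (mc_size pP).
  by apply: str => //; apply: direct_inv.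
apply: direct_eq dh; rewrite fE comp1VK; exact: e_refl.
Qed.

(** The longest element of W_{r,s,t} divides [P], so the model triangle extended on the right by [z]
    sits over the same class. By uniqueness, [f] and [g] differ from its sides by cells behind the
    first letters, and those at [s] cancel. *)
Lemma fills_sorted P r s t : size P <= n -> (r < s)%O -> (s < t)%O ->
  (forall a, a \in [set r; s; t]%SET -> descent a (head hW P)) ->
  fills P t s r.
Proof.
move=> Pn lrs lst dP p q o f g pP df dg.
have [p0 [q0 [o0 [f0 [g0 [rp pw df0 dg0 dfg]]]]]] := zamolodchikov lrs lst dP.
have [z Pz] := factor_w0 dP rp pw.
have pE : unword (cns t p) ~ unword (cns t (p0 ** word z)).
  by apply: mc_trans pP _; rewrite /= unword_cat wordK.
have [i] := mc_cell hW (mc_cancel hW pE).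
have [j] : inhabited (cell (q0 ** word z) q).
  apply: (mc_cell hW); apply: (mc_cancel hW (s := s)).
  apply: mc_trans (cell_mc f); apply: mc_trans (mc_sym pE).
  by apply: (@cell_mc _ _ _ (cns s (q0 ** word z))); exact: (tinv f0 \*0 idc (word z)).
have [k] : inhabited (cell (o0 ** word z) o).
  apply: (mc_cell hW); apply: (mc_cancel hW (s := r)).
  apply: mc_trans (cell_mc (f \*1 g)); apply: mc_trans (mc_sym pE).
  apply: (@cell_mc _ _ _ (cns r (o0 ** word z)));
    exact: (tinv (f0 \*1 g0) \*0 idc (word z)).
pose F : cell (cns t (p0 ** word z)) (cns s (q0 ** word z)) := f0 \*0 idc (word z).
pose G : cell (cns s (q0 ** word z)) (cns r (o0 ** word z)) := g0 \*0 idc (word z).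
have dF : direct F := direct_rcell (word z) df0.
have dG : direct G := direct_rcell (word z) dg0.
have dFG : direct (F \*1 G).
  apply: direct_eq (direct_rcell (word z) dfg).
  have E := comp0_proper (cell_eq_refl (gen := gen) (f0 \*1 g0))
              (comp1l (gen := gen) (idc (word z))).
  exact: e_trans (e_sym E) (comp01 _ _ _ _).
have fE : f =c (lcell t i \*1 F) \*1 lcell s j.
  apply: (direct_unique coherent_below _ df); first by rewrite (mc_size pP).
  exact/direct_absorbr/direct_absorbl.
have gE : g =c (lcell s (tinv j) \*1 G) \*1 lcell r k.
  apply: (direct_unique coherent_below _ dg).
    by rewrite -(cell_size f) (mc_size pP).
  exact/direct_absorbr/direct_absorbl.
apply: direct_eq (direct_absorbr k (direct_absorbl i dFG)).
symmetry; rewrite fE gE -!lcellV !comp1A comp1K; exact: e_refl.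
Qed.

Lemma triangle s t r p q o (f : cell (cns s p) (cns t q)) (g : cell (cns t q) (cns r o)) :
  uniq [:: s; t; r] -> size (unword (cns s p)) <= n ->
  direct f -> direct g -> direct (f \*1 g).
Proof.
rewrite /= !inE negb_or andbT => /andP[/andP[st sr] tr] pn df dg.
set P := unword (cns s p); have Pn : size P <= n := pn.
suff : fills P s t r by apply=> //; apply: mc_refl.
have ds : descent s (head hW P) := descent_head hW s (unword p).
have dt : descent t (head hW P).
  by rewrite (head_mc hW (cell_mc f)); apply: descent_head.
have dr : descent r (head hW P).
  by rewrite (head_mc hW (cell_mc (f \*1 g))); apply: descent_head.
(* Reversal and swap generate all six orders of the three letters from the decreasing one. *)
have sorted a b c : (a < b)%O -> (b < c)%O ->
    descent a (head hW P) -> descent b (head hW P) -> descent c (head hW P) ->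
    [/\ fills P a b c, fills P a c b & fills P b a c] /\
    [/\ fills P b c a, fills P c a b & fills P c b a].
  move=> ab bc da db dc; have cba : fills P c b a.
    by apply: fills_sorted => // e; rewrite !inE => /orP[/orP[]|]/eqP->.
  have abc := fills_rev cba; have cab := fills_swap Pn cba.
  have acb := fills_swap Pn abc; have bac := fills_rev cab.
  by do 2!split=> //; apply: fills_rev.
have [lst|lts|] := Order.TotalTheory.ltgtP s t; last by move=> E; rewrite E eqxx in st.
  have [lsr|lrs|] := Order.TotalTheory.ltgtP s r; last by move=> E; rewrite E eqxx in sr.
    have [ltr|lrt|] := Order.TotalTheory.ltgtP t r; last by move=> E; rewrite E eqxx in tr.
      by have [[? ? ?] [? ? ?]] := sorted s t r lst ltr ds dt dr.
    by have [[? ? ?] [? ? ?]] := sorted s r t lsr lrt ds dr dt.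
  by have [[? ? ?] [? ? ?]] := sorted r s t lrs lst dr ds dt.
have [ltr|lrt|] := Order.TotalTheory.ltgtP t r; last by move=> E; rewrite E eqxx in tr.
  have [lsr|lrs|] := Order.TotalTheory.ltgtP s r; last by move=> E; rewrite E eqxx in sr.
    by have [[? ? ?] [? ? ?]] := sorted t s r lts lsr dt ds dr.
  by have [[? ? ?] [? ? ?]] := sorted t r s ltr lrs dt dr ds.
by have [[? ? ?] [? ? ?]] := sorted r t s lrt lts dr dt ds.
Qed.

End Fill.

Lemma cells_coherent p q (f g : cell p q) : f =c g.
Proof.
have [n] := ubnP (size (unword p)); elim: n p q f g => // n IH p q f g pn.
apply: (coherent_step (n := n)) => //; exact: triangle.
Qed.

Lemma Art3_homotopy_basis : homotopy_basis (Art3 m gen).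
Proof. by move=> [] [] p q f g; apply: cells_coherent. Qed.

End CoherentPresentation.

Theorem theorem4p1p1 (d : Order.disp_t) (S : finOrderType d)
    (m : S -> S -> option nat) (W : groupType) (gen : S -> W)
    (hW : coxeter_group m gen) :
  coherent_presentation (Art3 m gen) (monoid_category (artin_monoid m)).
Proof.
split; first exact: (presented_isomorphic (cox_sym hW)).
exact: Art3_homotopy_basis.
Qed.
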